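(* Let $m\ge 1$, $1\le p<\infty$, and let $U\subset F_B(\mathbb{R}^m)$. Then $U$ is relatively compact in $(F_B(\mathbb{R}^m), d_p)$ if and only if (i) $U$ is uniformly $p$-mean bounded; (ii) $U$ is $p$-mean equi-left-continuous; and (iii$'$) for every sequence $\{u_n: n=1,2,\ldots\}\subset U$ there exist $r>0$ and a subsequence $\{v_n\}$ of $\{u_n\}$ such that $\lim_{n\to\infty}|v_n|^r=0$, where $|\cdot|^r$ is the functional defined in the context (the $r$ is a superscript index, not a power).
   Context: $H$ is the Hausdorff metric on nonempty closed subsets of $\mathbb{R}^m$ (Euclidean distance): $H(A,B)=\max\{\sup_{a\in A}\inf_{b\in B}d(a,b),\ \sup_{b\in B}\inf_{a\in A}d(a,b)\}$. A fuzzy set on $\mathbb{R}^m$ is a function $u:\mathbb{R}^m\to[0,1]$; its cuts are $[u]_\alpha=\{x: u(x)\ge\alpha\}$ for $\alpha\in(0,1]$ and $[u]_0=\overline{\{x: u(x)>0\}}$. $F_B(\mathbb{R}^m)$ is the set of fuzzy sets $u$ on $\mathbb{R}^m$ that are normal ($u(x_0)=1$ for some $x_0$), upper semi-continuous, and have $[u]_0$ bounded. The metric is $d_p(u,v)=\left(\int_0^1 H([u]_\alpha,[v]_\alpha)^p\,d\alpha\right)^{1/p}$. A set $U$ of such fuzzy sets is uniformly $p$-mean bounded if there is $M>0$ with $d_p(u,\widehat{0})\le M$ for all $u\in U$, where $\widehat 0$ is the characteristic function of $\{0\}$ ($0$ the origin). $U$ is $p$-mean equi-left-continuous if for every $\varepsilon>0$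 there is $\delta>0$ such that for all $0\le h<\delta$ and all $u\in U$, $\left(\int_h^1 H([u]_\alpha,[u]_{\alpha-h})^p\,d\alpha\right)^{1/p}<\varepsilon$. For $r>0$ let $B_r=\{x\in\mathbb{R}^m:\|x\|\le r\}$, let $\widehat{B_r}$ be its characteristic function, and for $u\in F_B(\mathbb{R}^m)$ put $|u|^r:=\left(\int_0^1 H([u\vee\widehat{B_r}]_\alpha,[\widehat{B_r}]_\alpha)^p\,d\alpha\right)^{1/p}$, where $\vee$ is the pointwise maximum. A subset of a metric space $X$ is relatively compact in $X$ if its closure in $X$ is compact. *)

(* Defs.v *)
From HB Require Import structures.
From mathcomp Require Import all_boot all_order all_algebra.
From mathcomp Require Import all_classical all_reals all_analysis.

Set Implicit Arguments.
Unset Strict Implicit.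
Unset Printing Implicit Defensive.

Import Order.TTheory GRing.Theory Num.Theory.
Import numFieldNormedType.Exports.

Local Open Scope classical_set_scope.
Local Open Scope ring_scope.

(* The library norm on 'rV[R]_m is the sup norm, so the Euclidean norm is
   defined here.  Both induce the library (entrywise) topology of 'rV[R]_m. *)
Definition eucl_norm (R : realType) (m : nat) (x : 'rV[R]_m) : R :=
  Num.sqrt (\sum_(i < m) x ord0 i ^+ 2).

(* Extended-real valued, since H(A, B) may be infinite when A or B is
   unbounded; meaningful for nonempty A and B. *)
Definition hausdorff (R : realType) (m : nat) (A B : set 'rV[R]_m) : \bar R :=
  maxe
    (ereal_sup [set ereal_inf [set (eucl_norm (a - b))%:E | b in B] | a in A])
    (ereal_sup [set ereal_inf [set (eucl_norm (a - b))%:E | a in A] | b in B]).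

Definition alpha_cut (R : realType) (m : nat) (u : 'rV[R]_m -> R) (alpha : R) :
    set 'rV[R]_m :=
  if 0 < alpha then [set x | alpha <= u x] else closure [set x | 0 < u x].

Definition upper_semicontinuous (R : realType) (m : nat)
    (u : 'rV[R]_m -> R) : Prop :=
  forall (x : 'rV[R]_m) (a : R), u x < a -> \forall y \near x, u y < a.

Record FB (R : realType) (m : nat) := MkFB {
  FB_fun :> 'rV[R]_m -> R ;
  FB_range : forall x, 0 <= FB_fun x <= 1 ;
  FB_normal : exists x0, FB_fun x0 = 1 ;
  FB_usc : upper_semicontinuous FB_fun ;
  FB_bounded : exists M : R, forall x, alpha_cut FB_fun 0 x -> eucl_norm x <= M
}.

(* (\int_a^1 F(alpha)^p d alpha)^(1/p) for F >= 0 and a <= 1; it is 0 when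
   1 < a. *)
Definition pmean (R : realType) (p a : R) (F : R -> \bar R) : \bar R :=
  poweR (\int[lebesgue_measure]_(alpha in `[a, 1%R]) poweR (F alpha) p)%E p^-1.

(* d_p is defined on arbitrary functions so that it applies directly to
   characteristic functions. *)
Definition dp (R : realType) (m : nat) (p : R) (u v : 'rV[R]_m -> R) : \bar R :=
  pmean p 0 (fun alpha => hausdorff (alpha_cut u alpha) (alpha_cut v alpha)).

(* FB carrying the topology of the metric d_p: a set is open when it contains
   a d_p-ball around each of its points. *)
Definition FBdp (R : realType) (m : nat) (p : R) : Type := FB R m.

Section FBdp_topology.
Variables (R : realType) (m : nat) (p : R).

Definition dp_open : set_system (FBdp m p) :=
  [set A | forall u : FB R m, A u ->
    exists2 e : R, 0 < e & forall v : FB R m, (dp p u v < e%:E)%E -> A v].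

Lemma dp_openT : dp_open setT.
Proof. by move=> u _; exists 1. Qed.

Lemma dp_openI : setI_closed dp_open.
Proof.
move=> A B oA oB u [/oA[e e0 Ae] /oB[e' e'0 Be]].
exists (Num.min e e'); first by rewrite lt_min e0.
move=> v; rewrite EFin_min lt_min => /andP[ve ve'].
by split; [exact: Ae | exact: Be].
Qed.

Lemma dp_open_bigU (I : Type) (f : I -> set (FBdp m p)) :
  (forall i, dp_open (f i)) -> dp_open (\bigcup_i f i).
Proof.
move=> of_ u [i _ /of_[e e0 fe]]; exists e => // v /fe fv.
by exists i.
Qed.

HB.instance Definition _ := gen_eqMixin (FBdp m p).
HB.instance Definition _ := gen_choiceMixin (FBdp m p).
HB.instance Definition _ :=
  isOpenTopological.Build (FBdp m p) dp_openT dp_openI dp_open_bigU.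

End FBdp_topology.

Definition relatively_compact (T : topologicalType) (A : set T) : Prop :=
  compact (closure A).

Definition fuzzy_zero (R : realType) (m : nat) : 'rV[R]_m -> R := \1_[set 0].

Definition uniformly_pmean_bounded (R : realType) (m : nat) (p : R)
    (U : set (FB R m)) : Prop :=
  exists2 M : R, 0 < M & forall u, U u -> (dp p u (@fuzzy_zero R m) <= M%:E)%E.

Definition pmean_equi_left_continuous (R : realType) (m : nat) (p : R)
    (U : set (FB R m)) : Prop :=
  forall e : R, 0 < e -> exists2 delta : R, 0 < delta &
    forall (h : R) (u : FB R m), 0 <= h -> h < delta -> U u ->
      (pmean p h (fun alpha => hausdorff (alpha_cut u alpha) (alpha_cut u (alpha - h)))
         < e%:E)%E.

Definition eucl_ball (R : realType) (m : nat) (r : R) : set 'rV[R]_m :=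
  [set x | eucl_norm x <= r].

Definition fuzzy_ball (R : realType) (m : nat) (r : R) : 'rV[R]_m -> R :=
  \1_(eucl_ball r).

Definition excess (R : realType) (m : nat) (p r : R) (u : FB R m) : \bar R :=
  dp p (u \max fuzzy_ball r) (fuzzy_ball r).

(* Main.v *)
(* Relative compactness means that every sequence in U has a d_p-cluster point
   in FB.  Given such cluster points, (i), (ii) and (iii') are each proved by
   comparing a bad sequence with its cluster point u: u is bounded for d_p, its
   oscillation H([u]_a, [u]_(a-h)) tends to 0 in p-mean by dominated
   convergence, and the excess over a ball containing [u]_0 is at most d_p.

   Conversely, take v_n with |v_n|^r -> 0 and an ultrafilter on the indices.
   For 0 < a <= 1 the cuts [v_n]_a eventually lie in a fixed ball, hence have a
   limit K_a inside B_r along the ultrafilter, and u x := sup {a | x in K_a} is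
   in FB.  On (2h, 1] the cuts of v_n and u are compared through the finitely
   many levels j h, up to the oscillations of u and v_n, which (ii) controls;
   on (0, 2h] the distance is at most 2r plus the excess of v_n.

   Quasi-triangle inequalities (with constants 4 and 8) replace Minkowski's
   inequality; they suffice for statements about the topology. *)
Require Import Defs.
From mathcomp Require Import all_boot all_order all_algebra.
From mathcomp Require Import all_classical all_reals all_analysis.
From mathcomp Require Import measurable_realfun ring lra.
Set Implicit Arguments.
Unset Strict Implicit.
Unset Printing Implicit Defensive.
Import Order.TTheory GRing.Theory Num.Theory.
Import numFieldNormedType.Exports.
Local Open Scope classical_set_scope.
Local Open Scope ring_scope.

(** * Euclidean norm and directed Hausdorff distances *)

Section euclidean_norm.
Context {R : realType} {m : nat}.
Implicit Types (x y z : 'rV[R]_m) (A B C : set 'rV[R]_m).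

Lemma eucl_norm_ge0 x : 0 <= eucl_norm x.
Proof. exact: sqrtr_ge0. Qed.

Lemma sqr_eucl_norm x : eucl_norm x ^+ 2 = \sum_(i < m) x ord0 i ^+ 2.
Proof. by rewrite sqr_sqrtr// sumr_ge0// => i _; exact: sqr_ge0. Qed.

Lemma coord_le_eucl_norm x (i : 'I_m) : `|x ord0 i| <= eucl_norm x.
Proof.
rewrite -sqrtr_sqr ler_sqrt ?sumr_ge0// => [|j _]; last exact: sqr_ge0.
by rewrite (bigD1 i)//= lerDl sumr_ge0// => j _; exact: sqr_ge0.
Qed.

Lemma eucl_norm_eq0 x : eucl_norm x = 0 -> x = 0.
Proof.
move=> x0; apply/rowP => i; rewrite mxE; apply/normr0_eq0/le_anti.
by rewrite normr_ge0 andbT -x0 coord_le_eucl_norm.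
Qed.

Lemma eucl_norm0 : eucl_norm (0 : 'rV[R]_m) = 0.
Proof.
by rewrite /eucl_norm big1 ?sqrtr0// => i _; rewrite mxE expr0n.
Qed.

Lemma eucl_normN x : eucl_norm (- x) = eucl_norm x.
Proof. by congr Num.sqrt; apply: eq_bigr => i _; rewrite mxE sqrrN. Qed.

Lemma eucl_distC x y : eucl_norm (x - y) = eucl_norm (y - x).
Proof. by rewrite -opprB eucl_normN. Qed.

(** Expand the nonnegative sum of the squares of [|y| x_i - |x| y_i] and divide by [|x| |y|]; a zero
    vector is treated apart. *)
Lemma cauchy_schwarz x y :
  \sum_(i < m) x ord0 i * y ord0 i <= eucl_norm x * eucl_norm y.
Proof.
have [x0|x0] := eqVneq (eucl_norm x) 0.
  rewrite x0 mul0r big1// => i _.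
  by rewrite (eucl_norm_eq0 x0) mxE mul0r.
have [y0|y0] := eqVneq (eucl_norm y) 0.
  rewrite y0 mulr0 big1// => i _.
  by rewrite (eucl_norm_eq0 y0) mxE mulr0.
have xy0 : 0 < eucl_norm x * eucl_norm y.
  by rewrite mulr_gt0// lt0r ?x0 ?y0 eucl_norm_ge0.
have : 0 <= \sum_(i < m)
    (eucl_norm y * x ord0 i - eucl_norm x * y ord0 i) ^+ 2.
  by rewrite sumr_ge0// => i _; exact: sqr_ge0.
under eq_bigr => i _.
  rewrite (_ : _ ^+ 2 = eucl_norm y ^+ 2 * x ord0 i ^+ 2
    + eucl_norm x ^+ 2 * y ord0 i ^+ 2
    - 2 * (eucl_norm x * eucl_norm y) * (x ord0 i * y ord0 i)); last ring.
  over.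
rewrite !big_split/= sumrN -!mulr_sumr -!sqr_eucl_norm.
move=> h; rewrite -(ler_pM2l xy0); nra.
Qed.

Lemma eucl_norm_triangle x y : eucl_norm (x + y) <= eucl_norm x + eucl_norm y.
Proof.
rewrite -(@ler_pXn2r _ 2)// ?nnegrE ?addr_ge0 ?eucl_norm_ge0//.
rewrite sqrrD !sqr_eucl_norm.
under eq_bigr do rewrite mxE sqrrD.
rewrite !big_split/= lerD2r lerD2l.
by rewrite mulr2n lerD ?cauchy_schwarz.
Qed.

Lemma eucl_dist_triangle y x z :
  eucl_norm (x - z) <= eucl_norm (x - y) + eucl_norm (y - z).
Proof. by rewrite -{1}(subrK y x) -addrA eucl_norm_triangle. Qed.

Lemma continuous_eucl_norm : continuous (@eucl_norm R m).
Proof.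
move=> x; apply: (@continuous_comp _ _ _
  (fun x : 'rV[R]_m => \sum_(i < m) x ord0 i ^+ 2) Num.sqrt).
  apply: (@cvg_big _ _ +%R 0 xpredT add_continuous _ _ _ _ _
    (nbhs_filter x)) => i _.
  have := @coord_continuous R 1 m ord0 i x.
  by move=> ci; rewrite expr2; under eq_fun do rewrite expr2; exact: (cvgM ci ci).
exact: sqrt_continuous.
Qed.

Lemma continuous_eucl_dist x : continuous (fun y => eucl_norm (x - y)).
Proof.
move=> y; apply: (@continuous_comp _ _ _ (fun y => x - y) (@eucl_norm R m)).
  by apply: (@continuousB _ _ _ (cst x) id); [exact: cst_continuous|].
exact: continuous_eucl_norm.
Qed.

Lemma nbhs_eucl_ball x (e : R) : 0 < e ->
  \forall y \near x, eucl_norm (x - y) < e.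
Proof.
move=> e0; apply: (cvgr_lt _ (@continuous_eucl_dist x x)).
by rewrite subrr eucl_norm0.
Qed.

Lemma closed_eucl_ball (r : R) : closed (@eucl_ball R m r).
Proof.
rewrite (_ : eucl_ball r = @eucl_norm R m @^-1` [set t | t <= r])//.
apply: preimage_closed; last exact: closed_le.
by move=> x _; exact: continuous_eucl_norm.
Qed.

Lemma compact_eucl_ball (r : R) : compact (@eucl_ball R m r).
Proof.
apply: bounded_closed_compact; last exact: closed_eucl_ball.
exists r; split; first exact: num_real.
move=> M rM x /= xr; rewrite [`|x|]mx_normrE.
apply: bigmax_le => [|[i j] _ /=].
  by rewrite (le_trans (eucl_norm_ge0 x))// (le_trans xr)// ltW.
by rewrite ord1 (le_trans (coord_le_eucl_norm x j))// (le_trans xr)// ltW.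
Qed.

End euclidean_norm.

Section directed_distance.
Context {R : realType} {m : nat}.
Implicit Types (x y z : 'rV[R]_m) (A B C : set 'rV[R]_m) (e : \bar R).
Local Open Scope ereal_scope.

(** Equal to [+oo] for empty [A], while [directed_dist] is [-oo] for an empty first argument; hence
    the nonemptiness assumptions below. *)
Definition point_dist x A : \bar R :=
  ereal_inf [set (eucl_norm (x - y))%:E | y in A].

Definition directed_dist A B : \bar R :=
  ereal_sup [set point_dist x B | x in A].

Lemma hausdorffE A B :
  hausdorff A B = maxe (directed_dist A B) (directed_dist B A).
Proof.
congr maxe; congr ereal_sup.
apply: eq_imagel => b _; congr ereal_inf.
by apply: eq_imagel => a _; rewrite eucl_distC.
Qed.

Lemma hausdorffC A B : hausdorff A B = hausdorff B A.
Proof. by rewrite !hausdorffE maxC. Qed.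

Lemma hausdorff_le A B e :
  directed_dist A B <= e -> directed_dist B A <= e -> hausdorff A B <= e.
Proof. by move=> ? ?; rewrite hausdorffE ge_max; apply/andP. Qed.

Lemma directed_dist_le_hausdorff A B : directed_dist A B <= hausdorff A B.
Proof. by rewrite hausdorffE le_max lexx. Qed.

Lemma point_dist_ge0 x A : 0 <= point_dist x A.
Proof.
by apply: le_ereal_inf_tmp => _ [y _ <-]; rewrite lee_fin eucl_norm_ge0.
Qed.

Lemma point_dist_le x y A : A y -> point_dist x A <= (eucl_norm (x - y))%:E.
Proof. by move=> Ay; apply: ereal_inf_lbound; exists y. Qed.

Lemma point_dist_le_directed x A B : A x -> point_dist x B <= directed_dist A B.
Proof. by move=> Ax; apply: ereal_sup_ubound; exists x. Qed.

Lemma point_dist_directed x A B :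
  A !=set0 -> point_dist x B <= point_dist x A + directed_dist A B.
Proof.
move=> [a0 Aa0]; have [->|foo] := eqVneq (directed_dist A B) +oo.
  by rewrite addey ?leey// -ltNye (lt_le_trans _ (point_dist_ge0 _ _)).
have AB0 : 0 <= directed_dist A B.
  exact: le_trans (point_dist_ge0 a0 B) (point_dist_le_directed _ Aa0).
have ABfin : directed_dist A B \is a fin_num by rewrite ge0_fin_numE// ltey.
rewrite -leeBlDr//; apply: le_ereal_inf_tmp => _ [a Aa <-].
rewrite leeBlDr//.
have h : point_dist x B <= (eucl_norm (x - a))%:E + point_dist a B.
  rewrite -leeBlDl//; apply: le_ereal_inf_tmp => _ [b Bb <-].
  rewrite leeBlDl// (le_trans (point_dist_le x Bb))//.
  by rewrite -EFinD lee_fin eucl_dist_triangle.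
by rewrite (le_trans h)// leeD2l// point_dist_le_directed.
Qed.

Lemma directed_dist_ge0 A B : A !=set0 -> 0 <= directed_dist A B.
Proof.
move=> [a Aa].
exact: le_trans (point_dist_ge0 a B) (point_dist_le_directed _ Aa).
Qed.

Lemma hausdorff_ge0 A B : A !=set0 -> 0 <= hausdorff A B.
Proof.
move=> A0; exact: le_trans (directed_dist_ge0 B A0)
  (directed_dist_le_hausdorff _ _).
Qed.

Lemma directed_dist_triangle B A C : B !=set0 ->
  directed_dist A C <= directed_dist A B + directed_dist B C.
Proof.
move=> B0; apply: ge_ereal_sup => _ [a Aa <-].
apply: (le_trans (point_dist_directed a C B0)).
by rewrite leeD2r// point_dist_le_directed.
Qed.

Lemma hausdorff_triangle B A C : B !=set0 ->
  hausdorff A C <= hausdorff A B + hausdorff B C.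
Proof.
move=> B0; apply: hausdorff_le.
  apply: (le_trans (directed_dist_triangle A C B0)).
  by rewrite leeD// directed_dist_le_hausdorff.
apply: (le_trans (directed_dist_triangle C A B0)).
rewrite addeC; apply: leeD.
  by rewrite hausdorffC directed_dist_le_hausdorff.
by rewrite [leRHS]hausdorffC directed_dist_le_hausdorff.
Qed.

Lemma directed_dist_subset A A' B B' :
  A `<=` A' -> B' `<=` B -> directed_dist A B <= directed_dist A' B'.
Proof.
move=> AA' BB'; apply: ge_ereal_sup => _ [a Aa <-].
apply: (@le_trans _ _ (point_dist a B')).
  by apply: ereal_inf_le_tmp => _ [b Bb <-]; exists b => //; exact: BB'.
by apply: point_dist_le_directed; exact: AA'.
Qed.

Lemma directed_dist_near A B (r : R) :
  (forall a, A a -> exists2 b, B b & (eucl_norm (a - b) <= r)%R) ->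
  directed_dist A B <= r%:E.
Proof.
move=> AB; apply: ge_ereal_sup => _ [a /AB[b Bb abr] <-].
by rewrite (le_trans (point_dist_le a Bb)).
Qed.

Lemma directed_dist_sub A B : A !=set0 -> A `<=` B -> directed_dist A B = 0.
Proof.
move=> A0 AB; apply/eqP; rewrite eq_le directed_dist_ge0// andbT.
apply: directed_dist_near => a Aa; exists a; first exact: AB.
by rewrite subrr eucl_norm0.
Qed.

End directed_distance.

(** [A] lies in [B] and in [C], so only the distance from the larger set back to [A] counts, and it
    is monotone in that set. *)
Lemma hausdorff_nested {R : realType} {m : nat} (A B C : set 'rV[R]_m) :
  A !=set0 -> A `<=` B -> B `<=` C -> (hausdorff A B <= hausdorff A C)%E.
Proof.
move=> A0 AB BC; apply: hausdorff_le.
  by rewrite directed_dist_sub// hausdorff_ge0.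
rewrite (le_trans (directed_dist_subset BC (@subset_refl _ A)))//.
by rewrite hausdorffC directed_dist_le_hausdorff.
Qed.

(** * Cuts of fuzzy sets *)

Section cuts.
Context {R : realType} {m : nat}.
Implicit Types (u v : FB R m) (x y : 'rV[R]_m) (a b e : R).

Lemma cut_pos (f : 'rV[R]_m -> R) a :
  0 < a -> alpha_cut f a = [set x | a <= f x].
Proof. by rewrite /alpha_cut => ->. Qed.

(** Nonpositive levels all give the closed support, so cuts at [a - h] make sense without assuming
    [h <= a]. *)
Lemma cut_npos (f : 'rV[R]_m -> R) a : a <= 0 -> alpha_cut f a = alpha_cut f 0.
Proof. by rewrite /alpha_cut ltNge => ->; rewrite ltxx. Qed.

Lemma cut_anti (f : 'rV[R]_m -> R) a b :
  a <= b -> alpha_cut f b `<=` alpha_cut f a.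
Proof.
move=> ab; have [b0|b0] := leP b 0.
  by rewrite !cut_npos ?(le_trans ab).
have [a0|a0] := leP a 0.
  rewrite (cut_npos _ a0) (cut_pos _ b0) /alpha_cut ltxx.
  by move=> x /= bx; apply: subset_closure => /=; exact: lt_le_trans bx.
by rewrite !cut_pos// => x; exact: le_trans.
Qed.

Lemma cut_nonempty u a : a <= 1 -> alpha_cut u a !=set0.
Proof.
move=> a1; have [x ux] := FB_normal u; exists x.
by apply: (cut_anti a1); rewrite cut_pos//= ux.
Qed.

Lemma FB_supported u :
  exists2 M, 0 < M & forall a, alpha_cut u a `<=` eucl_ball M.
Proof.
have [M uM] := FB_bounded u; exists (Num.max 1 M); first by rewrite lt_max ltr01.
move=> a x ax; rewrite /eucl_ball/= le_max uM ?orbT//.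
have [a0|/ltW a0] := leP a 0; first by rewrite -(cut_npos _ a0).
exact: cut_anti a0 _ ax.
Qed.

(** Compactness: [u < a] on the points of a large ball at distance at least [e] from the [a]-cut,
    and upper semicontinuity improves this to [u < a - d] with a single [d], so the cuts from level
    [a - d] on avoid these points. *)
Lemma cut_left_continuous u a e : 0 < e ->
  exists2 d, 0 < d & forall b, a - d <= b ->
    forall x, alpha_cut u b x ->
      exists2 y, alpha_cut u a y & eucl_norm (x - y) < e.
Proof.
move=> e0; have [a0|a0] := leP a 0.
  exists 1 => // b _ x bx; exists x; last by rewrite subrr eucl_norm0.
  rewrite cut_npos//; have [b0|/ltW b0] := leP b 0; first by rewrite -(cut_npos _ b0).
  exact: cut_anti b0 _ bx.
have [M M0 uM] := FB_supported u.
pose C : set 'rV[R]_m := eucl_ball M `&`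
  \bigcap_(y in alpha_cut u a) [set x | e <= eucl_norm (y - x)].
have cC : compact C.
  apply: (subclosed_compact _ (@compact_eucl_ball R m M)); last by move=> x [].
  apply: closedI; first exact: closed_eucl_ball.
  apply: closed_bigI => y _.
  apply: (@preimage_closed _ _ (fun x => eucl_norm (y - x)) [set t | e <= t]).
    by move=> x _; exact: continuous_eucl_dist.
  exact: closed_ge.
have : \forall d \near (0 : R)^'+, C `<=` (fun x => u x < a - d).
  apply: (iffLR (compact_near_coveringP _) cC R (0 : R)^'+ (fun d x => u x < a - d)).
  move=> x [_ Cx].
  have uxa : u x < a.
    rewrite ltNge; apply/negP => aux.
    have /= := Cx x; rewrite cut_pos//= => /(_ aux).
    by rewrite subrr eucl_norm0 leNgt e0.
  (* The gap between [u x] and [a] is halved: one half absorbs the variation of [u] near [x], the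
     other absorbs [d]. *)
  exists ([set y | u y < (u x + a) / 2], [set d | d < (a - u x) / 2]) => /=.
    split; first by apply: FB_usc; lra.
    by apply: nbhs_right_lt; lra.
  move=> [y d] /= [h1 h2]; lra.
move=> Cd; near (0 : R)^'+ => d.
have d0 : 0 < d by near: d; exact: nbhs_right_gt.
have da : d < a by near: d; exact: nbhs_right_lt.
exists d => // b db x bx; apply: contrapT => hx.
have xad := cut_anti db bx; rewrite cut_pos ?subr_gt0//= in xad.
have Cx : C x.
  split; first exact: uM bx.
  move=> y ay /=; rewrite leNgt; apply/negP => yx; apply: hx; exists y => //.
  by rewrite eucl_distC.
suff : C `<=` (fun x => u x < a - d) by move=> /(_ x Cx); rewrite ltNge xad.
by near: d.
Unshelve. all: by end_near. Qed.

(** Lowering the level slightly adds only points close to the [a]-cut; raising it only removes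
    points. *)
Lemma point_dist_cut_left u x a (c : R) :
  (c%:E < point_dist x (alpha_cut u a))%E ->
  exists2 d, 0 < d & forall b, a - d <= b ->
    (c%:E < point_dist x (alpha_cut u b))%E.
Proof.
move=> cx; have [e e0 ce] : exists2 e : R, 0 < e &
    ((c + e)%:E <= point_dist x (alpha_cut u a))%E.
  case: (point_dist x (alpha_cut u a)) cx => [t| |//].
    by rewrite lte_fin => ct; exists (t - c); rewrite ?subr_gt0// subrKC.
  by exists 1; rewrite // leey.
have [d d0 ud] := @cut_left_continuous u a (e / 2) (divr_gt0 e0 (ltr0n _ 2)).
exists d => // b db; apply: (@lt_le_trans _ _ (c + e / 2)%:E).
  by rewrite lte_fin ltrDl divr_gt0.
apply: le_ereal_inf_tmp => _ [y by_ <-]; rewrite lee_fin.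
have [z az yz] := ud b db y by_.
have := le_trans ce (point_dist_le x az); rewrite lee_fin.
have := eucl_dist_triangle y x z; lra.
Qed.

End cuts.

(** * Measurability of Hausdorff distances in the level *)

Section measurability.
Context {R : realType} {m : nat}.
Implicit Types (u v : FB R m).

(* A left-open set is the union, over the rationals q, of the intervals of the
   points that are joined to q within the set. *)
Lemma measurable_left_open (S : set R) :
  (forall a, S a -> exists2 d, 0 < d & forall b, a - d <= b <= a -> S b) ->
  measurable S.
Proof.
move=> Sl.
pose J (q : rat) := [set a : R | ratr q <= a /\ forall b, ratr q <= b <= a -> S b].
have -> : S = \bigcup_q J q.
  apply/seteqP; split=> [a Sa|a [q _ [qa]]]; last by apply; rewrite qa lexx.
  have [d d0 Sd] := Sl a Sa.
  have /rat_in_itvoo[q] : a - d < a by rewrite ltrBlDr ltrDl.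
  rewrite in_itv/= => /andP[/ltW dq /ltW qa]; exists q => //; split => // b /andP[qb ba].
  by apply: Sd; rewrite ba (le_trans dq).
apply: bigcupT_measurable_rat => q; apply: is_interval_measurable.
move=> x y [qx _] [qy Sy] z /andP[xz zy]; split; first exact: le_trans xz.
by move=> b /andP[qb bz]; apply: Sy; rewrite qb (le_trans bz).
Qed.

(** Superlevel sets of each directed distance are left-open: as the level drops slightly, a point of
    the first cut far from the second stays in the first cut, and stays far by
    [point_dist_cut_left]. The shifts cover oscillations as well. *)
Lemma measurable_hausdorff_cut u v (h k : R) :
  measurable_fun setT
    (fun a : R => hausdorff (alpha_cut u (a - h)) (alpha_cut v (a - k))).
Proof.
under eq_fun do rewrite hausdorffE.
suff mdd w w' (s t : R) : measurable_fun setT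
    (fun a : R => directed_dist (alpha_cut (w : FB R m) (a - s))
                                (alpha_cut (w' : FB R m) (a - t))).
  by apply: measurable_maxe; exact: mdd.
apply: (measurability _ (ErealGenOInfty.measurableE R)) => // _ [_ [c ->] <-].
rewrite setTI; apply: measurable_left_open => a /=; rewrite in_itv/= andbT.
move=> /ereal_sup_gt[_ [x ax <-]] cx.
have [d d0 cd] := point_dist_cut_left cx.
exists d => // b /andP[db ba]; rewrite in_itv/= andbT.
apply: (@lt_le_trans _ _ (point_dist x (alpha_cut w' (b - t)))).
  by apply: cd; lra.
by apply: point_dist_le_directed; apply: cut_anti ax; rewrite lerD2r.
Qed.

End measurability.

(** * The p-mean functional and the metric [dp] *)

Section lpnorm.
Context {R : realType}.
Implicit Types (p r a b c : R) (D : set R) (F G : R -> \bar R).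
Local Open Scope ereal_scope.

Lemma le_poweR (r : R) (x y : \bar R) :
  (0 <= r)%R -> 0 <= x -> x <= y -> x `^ r <= y `^ r.
Proof.
move=> r0 x0 xy; apply: gt0_ler_poweR => //; rewrite in_itv/= leey ?andbT//.
exact: le_trans xy.
Qed.

(** Bounding [x + y] by twice the maximum works for every exponent [r >= 0], so this serves both for
    [p] and for [p^-1]. *)
Lemma poweR_add_le (r : R) (x y : \bar R) : (0 <= r)%R -> 0 <= x -> 0 <= y ->
  (x + y) `^ r <= (2 `^ r)%:E * (x `^ r + y `^ r).
Proof.
move=> r0; wlog xy : x y / x <= y => [hw x0 y0|x0 y0].
  have [xy|/ltW yx] := leP x y; first exact: hw.
  by rewrite addeC [X in _ * X]addeC hw.
apply: (@le_trans _ _ ((2%:E * y) `^ r)).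
  apply: le_poweR => //; first exact: adde_ge0.
  by rewrite mule_natl mule2n leeD2r.
by rewrite poweRM// poweR_EFin lee_wpmul2l ?leeDr ?poweR_ge0// lee_fin powR_ge0.
Qed.

(** [pmean] over an arbitrary domain, so that the range of levels can be split. *)
Definition lpnorm p D F : \bar R :=
  (\int[lebesgue_measure]_(a in D) (F a `^ p)) `^ p^-1.

Lemma measurable_poweR_comp p D F :
  measurable_fun setT F -> measurable_fun D (fun a => F a `^ p).
Proof.
move=> mF; apply: measurable_funTS.
exact: (measurableT_comp (measurable_poweR p) mF).
Qed.

Context (p : R) (p1 : (1 <= p)%R).

Let p0 : (0 <= p)%R. Proof. exact: le_trans p1. Qed.
Let pN0 : p != 0%R. Proof. by rewrite gt_eqF// (lt_le_trans _ p1). Qed.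
Let pV0 : (0 <= p^-1)%R. Proof. by rewrite invr_ge0. Qed.

Lemma lpnorm_le D F G : measurable D ->
  measurable_fun setT F -> measurable_fun setT G ->
  (forall a, D a -> 0 <= F a <= G a) -> lpnorm p D F <= lpnorm p D G.
Proof.
move=> mD mF mG FG; apply: le_poweR => //.
  by apply: integral_ge0 => a _; exact: poweR_ge0.
apply: ge0_le_integral => //.
- by move=> a _; exact: poweR_ge0.
- exact: measurable_poweR_comp.
- exact: measurable_poweR_comp.
- by move=> a /FG/andP[F0 FGa]; exact: le_poweR.
Qed.

Lemma lpnorm_subset D D' F : measurable D -> measurable D' ->
  measurable_fun setT F -> D `<=` D' -> lpnorm p D F <= lpnorm p D' F.
Proof.
move=> mD mD' mF DD'; apply: le_poweR => //.
  by apply: integral_ge0 => a _; exact: poweR_ge0.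
apply: ge0_subset_integral => //; first exact: measurable_poweR_comp.
by move=> a _; exact: poweR_ge0.
Qed.

Lemma powR2_inv_le : (2 `^ p^-1 <= 2)%R.
Proof.
rewrite -[leRHS]powRr1//; apply: ler_powR; first by rewrite ler1n.
by rewrite invf_le1// (lt_le_trans _ p1).
Qed.

(** In the constant 4, one factor 2 is [(2^p)^(1/p)] and the other bounds [2^(1/p)]. *)
Lemma lpnorm_add D F G : measurable D ->
  measurable_fun setT F -> measurable_fun setT G ->
  (forall a, D a -> 0 <= F a) -> (forall a, D a -> 0 <= G a) ->
  lpnorm p D (F \+ G) <= 4%:E * (lpnorm p D F + lpnorm p D G).
Proof.
move=> mD mF mG F0 G0; rewrite /lpnorm.
set A := \int[_]_(_ in _) (F _ `^ p); set B := \int[_]_(_ in _) (G _ `^ p).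
have A0 : 0 <= A by apply: integral_ge0 => a _; exact: poweR_ge0.
have B0 : 0 <= B by apply: integral_ge0 => a _; exact: poweR_ge0.
apply: (@le_trans _ _ (((2 `^ p)%:E * (A + B)) `^ p^-1)).
  apply: le_poweR => //.
    by apply: integral_ge0 => a _; exact: poweR_ge0.
  have mFG : measurable_fun D (fun a => F a `^ p + G a `^ p).
    by apply: emeasurable_funD; exact: measurable_poweR_comp.
  have <- : \int[lebesgue_measure]_(a in D) (F a `^ p + G a `^ p) = A + B.
    apply: ge0_integralD => //; first by move=> a _; exact: poweR_ge0.
    - exact: measurable_poweR_comp.
    - by move=> a _; exact: poweR_ge0.
    - exact: measurable_poweR_comp.
  rewrite -ge0_integralZl_EFin ?powR_ge0//; last first.
    by move=> a _; rewrite adde_ge0 ?poweR_ge0.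
  apply: ge0_le_integral => //.
  - by move=> a _; exact: poweR_ge0.
  - by apply: measurable_poweR_comp; exact: emeasurable_funD.
  - exact: measurable_funeM.
  - by move=> a Da; apply: poweR_add_le; [|exact: F0|exact: G0].
rewrite poweRM ?lee_fin ?powR_ge0//; last exact: adde_ge0.
rewrite poweR_EFin -powRrM divff// powRr1//.
rewrite (_ : 4%:E = 2%:E * 2%:E); last by rewrite -EFinM; congr EFin; lra.
rewrite -muleA; apply: lee_wpmul2l; first by rewrite lee_fin.
apply: (le_trans (poweR_add_le pV0 A0 B0)).
apply: lee_wpmul2r; first by rewrite adde_ge0 ?poweR_ge0.
by rewrite lee_fin powR2_inv_le.
Qed.

Lemma lpnorm_setU D D' F : measurable D -> measurable D' ->
  measurable_fun setT F -> [disjoint D & D'] ->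
  lpnorm p (D `|` D') F <= 4%:E * (lpnorm p D F + lpnorm p D' F).
Proof.
move=> mD mD' mF DD'; rewrite /lpnorm ge0_integral_setU//; last 2 first.
- exact: measurable_poweR_comp.
- by move=> a _; exact: poweR_ge0.
have i0 E : 0 <= \int[lebesgue_measure]_(a in E) (F a `^ p).
  by apply: integral_ge0 => a _; exact: poweR_ge0.
apply: (le_trans (poweR_add_le _ _ _)) => //.
apply: lee_wpmul2r; first by rewrite adde_ge0 ?poweR_ge0.
by rewrite lee_fin (le_trans powR2_inv_le)// ler_nat.
Qed.

Lemma lpnorm_cst (a b c : R) : (a <= b)%R -> (0 <= c)%R ->
  lpnorm p `]a, b] (cst c%:E) = (c * (b - a) `^ p^-1)%:E.
Proof.
move=> ab c0; rewrite /lpnorm/= integral_cst//= lebesgue_measure_itv/= lte_fin.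
have -> : (if (a < b)%R then b%:E - a%:E else 0) = (b - a)%:E.
  by case: ltP => // ba; rewrite (@le_anti _ _ a b) ?ab// subrr.
rewrite !poweR_EFin powRM ?powR_ge0 ?subr_ge0//.
by rewrite -powRrM divff// powRr1.
Qed.

(** Dropping the null endpoint leaves, for [a >= 0], only positive levels, where cuts are plain
    superlevel sets. *)
Lemma pmeanE (a : R) F : measurable_fun setT F -> pmean p a F = lpnorm p `]a, 1%R] F.
Proof.
move=> mF; rewrite /pmean /lpnorm integral_itv_obnd_cbnd//.
exact: measurable_poweR_comp.
Qed.

End lpnorm.

(** * Translation invariance of the Lebesgue integral *)

(** The pushforward agrees with Lebesgue measure on the intervals []a, b]], which determine it. *)
Lemma lebesgue_measure_shift {R : realType} (h : R)
    (phi : measurableTypeR R -> measurableTypeR R) (A : set R) :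
  (forall x, phi x = x - h) -> measurable_fun setT phi -> measurable A ->
  pushforward lebesgue_measure phi A = lebesgue_measure A.
Proof.
move=> phiE mphi mA; symmetry.
pose mu : {measure set (measurableTypeR R) -> \bar R} :=
   measure_function_pushforward__canonical__measure_function_Measure (@lebesgue_measure R) mphi.
have muE : forall X, ocitv X -> lebesgue_measure X = mu X; last first.
  exact: (lebesgue_measure_unique muE mA).
move=> _ [[a b] /= _ <-].
rewrite /mu /pushforward/= (_ : _ @^-1` _ = `](a + h), (b + h)]%classic).
  by rewrite !lebesgue_measure_itv/= !lte_fin ltrD2r -!EFinB opprD addrACA subrr addr0.
by apply/seteqP; split => x /=; rewrite !in_itv/= phiE ltrBrDr lerBlDr.
Qed.

Lemma integral_shift {R : realType} (h a b : R) (F : R -> \bar R) :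
  measurable_fun setT F -> (forall x, 0 <= F x)%E ->
  (\int[lebesgue_measure]_(x in `](a + h)%R, (b + h)%R]%classic) F (x - h)%R =
  \int[lebesgue_measure]_(x in `]a, b]%classic) F x)%E.
Proof.
move=> mF F0; pose phi0 (x : measurableTypeR R) : measurableTypeR R := (x - h)%R.
have mphi : measurable_fun setT phi0 by exact: measurable_funB.
pose mu := measure_function_pushforward__canonical__measure_function_Measure
  (@lebesgue_measure R) mphi.
have muE (A : set (measurableTypeR R)) : measurable A -> A `<=` `]a, b] ->
    mu A = lebesgue_measure A.
  by move=> mA _; exact: (@lebesgue_measure_shift R h phi0).
rewrite -(eq_measure_integral _ muE).
rewrite ge0_integral_pushforward//; last exact: measurable_funTS.
congr integral.
by apply/seteqP; split => x /=; rewrite !in_itv/= ltrBrDr lerBlDr.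
Qed.

(** Translating by [h] turns the domain into []0, 1 - h]], a part of []0, 1]]. *)
Lemma lpnorm_shift {R : realType} (p h : R) (F : R -> \bar R) : 1 <= p ->
  0 <= h -> measurable_fun setT F ->
  (lpnorm p `]h, 1%R] (fun a => F (a - h)%R) <= lpnorm p `]0%R, 1%R] F)%E.
Proof.
move=> p1 h0 mF; have p0 : 0 <= p by exact: le_trans p1.
apply: (@le_trans _ _ (lpnorm p `]0%R, (1 - h)%R] F)); last first.
  apply: lpnorm_subset => // x /=; rewrite !in_itv/= => /andP[-> /le_trans]; apply.
  by rewrite gerBl.
have mFp : measurable_fun setT (fun x => F x `^ p)%E.
  exact: measurable_poweR_comp.
have := integral_shift h 0 (1 - h) mFp (fun x => poweR_ge0 (F x) p).
by rewrite /lpnorm add0r subrK => ->.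
Qed.

Lemma cvge0 {R : realType} (I : Type) (F : set_system I) {FF : Filter F}
    (f : I -> \bar R) :
  (forall e : R, 0 < e -> \forall i \near F, (0 <= f i <= e%:E)%E) ->
  f @ F --> 0%E.
Proof.
move=> fe; apply/fine_cvgP; split.
  have := fe 1 ltr01; apply: filterS => i /andP[fi0 fi1].
  by rewrite ge0_fin_numE// (le_lt_trans fi1)// ltry.
apply/cvgr0Pnorm_le => e /fe; apply: filterS => i /andP[fi0 fie] /=.
rewrite ger0_norm ?fine_ge0// -lee_fin fineK// ge0_fin_numE//.
by rewrite (le_lt_trans fie)// ltry.
Qed.

(** * The distance d_p and the oscillation of a fuzzy set *)

Section dp_metric.
Context {R : realType} {m : nat} (p : R) (p1 : 1 <= p).
Implicit Types (u v w : FB R m) (h e : R).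
Local Open Scope ereal_scope.

Lemma measurable_cuts u v :
  measurable_fun setT (fun a : R => hausdorff (alpha_cut u a) (alpha_cut v a)).
Proof.
under eq_fun => a do rewrite -[a in alpha_cut u a]subr0 -[a in alpha_cut v a]subr0.
exact: measurable_hausdorff_cut.
Qed.

Lemma dpE u v : dp p u v =
  lpnorm p `]0%R, 1%R] (fun a => hausdorff (alpha_cut u a) (alpha_cut v a)).
Proof. by rewrite /dp pmeanE//; exact: measurable_cuts. Qed.

Lemma hausdorff_cut_ge0 u (B : set 'rV[R]_m) (a : R) :
  (a <= 1)%R -> 0 <= hausdorff (alpha_cut u a) B.
Proof. by move=> a1; apply: hausdorff_ge0; exact: cut_nonempty. Qed.

Lemma dp_ge0 u v : 0 <= dp p u v.
Proof. exact: poweR_ge0. Qed.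

Lemma dp_sym u v : dp p u v = dp p v u.
Proof. by rewrite /dp; congr pmean; apply/funext => a; exact: hausdorffC. Qed.

Lemma dp_triangle v u w : dp p u w <= 4%:E * (dp p u v + dp p v w).
Proof.
rewrite !dpE; apply: (le_trans _ (lpnorm_add _ _ _ _ _ _)) => //.
- apply: lpnorm_le => //; first exact: measurable_cuts.
    by apply: emeasurable_funD; exact: measurable_cuts.
  move=> a /=; rewrite in_itv/= => /andP[_ a1].
  by rewrite hausdorff_cut_ge0//= hausdorff_triangle//; exact: cut_nonempty.
- exact: measurable_cuts.
- exact: measurable_cuts.
- by move=> a /=; rewrite in_itv/= => /andP[_ a1]; exact: hausdorff_cut_ge0.
- by move=> a /=; rewrite in_itv/= => /andP[_ a1]; exact: hausdorff_cut_ge0.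
Qed.

Lemma hausdorff_supported (A B : set 'rV[R]_m) (M N : R) : A !=set0 -> B !=set0 ->
  A `<=` eucl_ball M -> B `<=` eucl_ball N -> hausdorff A B <= (M + N)%:E.
Proof.
move=> [a0 Aa0] [b0 Bb0] AM BN.
have tri a b : A a -> B b -> (eucl_norm (a - b) <= M + N)%R.
  move=> /AM aM /BN bN; rewrite (le_trans (eucl_norm_triangle _ _))//.
  by rewrite eucl_normN lerD.
apply: hausdorff_le; apply: directed_dist_near.
  by move=> a Aa; exists b0 => //; exact: tri.
by move=> b Bb; exists a0 => //; rewrite eucl_distC; exact: tri.
Qed.

Lemma dp_finite u v : exists2 C : R, (0 <= C)%R & dp p u v <= C%:E.
Proof.
have [M M0 uM] := FB_supported u; have [N N0 vN] := FB_supported v.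
have MN0 : (0 <= M + N)%R by rewrite addr_ge0// ltW.
exists ((M + N) * (1 - 0) `^ p^-1)%R; first by rewrite mulr_ge0 ?powR_ge0.
rewrite -lpnorm_cst// dpE; apply: lpnorm_le => //; first exact: measurable_cuts.
move=> a /=; rewrite in_itv/= => /andP[_ a1].
rewrite hausdorff_cut_ge0//=.
by apply: hausdorff_supported; [exact: cut_nonempty|exact: cut_nonempty|exact: uM|exact: vN].
Qed.

Lemma dp_refl u : dp p u u = 0.
Proof.
apply/eqP; rewrite eq_le dp_ge0 andbT.
rewrite (_ : 0 = (0 * (1 - 0) `^ p^-1)%:E); last by rewrite mul0r.
rewrite -lpnorm_cst// dpE; apply: lpnorm_le => //; first exact: measurable_cuts.
move=> a /=; rewrite in_itv/= => /andP[_ a1]; rewrite hausdorff_cut_ge0//=.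
by rewrite hausdorffE maxxx directed_dist_sub//; exact: cut_nonempty.
Qed.

(** The integrand of equi-left-continuity; for [a <= h] it compares the cut with the whole
    support. *)
Definition oscillation u (h a : R) : \bar R :=
  hausdorff (alpha_cut u a) (alpha_cut u (a - h)%R).

Lemma measurable_oscillation u h : measurable_fun setT (oscillation u h).
Proof.
rewrite /oscillation; under eq_fun => a do rewrite -[a in alpha_cut u a]subr0.
exact: measurable_hausdorff_cut.
Qed.

Lemma oscillation_mono u (h k a : R) : (0 <= h)%R -> (h <= k)%R -> (a <= 1)%R ->
  oscillation u h a <= oscillation u k a.
Proof.
move=> h0 hk a1; apply: hausdorff_nested; first exact: cut_nonempty.
  by apply: cut_anti; rewrite gerBl.
by apply: cut_anti; rewrite lerD2l lerN2.
Qed.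

Lemma oscillation_small u (a e : R) : (a <= 1)%R -> (0 < e)%R ->
  exists2 d : R, (0 < d)%R &
    forall h, (0 <= h)%R -> (h <= d)%R -> oscillation u h a <= e%:E.
Proof.
move=> a1 e0; have [d d0 ud] := cut_left_continuous u a e0.
exists d => // h h0 hd; apply: hausdorff_le.
  rewrite directed_dist_sub ?lee_fin ?ltW//; first exact: cut_nonempty.
  by apply: cut_anti; rewrite gerBl.
apply: directed_dist_near => x /ud[|y ay xy]; first by rewrite lerD2l lerN2.
by exists y => //; exact: ltW.
Qed.

(** Dominated convergence along [h = 1/(n+1)]: the integrand tends to 0 by left continuity of the
    cuts and is at most [(M + M)^p]. Monotonicity in [h] then covers all smaller [h]. *)
Lemma lpnorm_oscillation u e : (0 < e)%R -> exists2 d : R, (0 < d)%R &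
  forall h, (0 <= h)%R -> (h < d)%R -> lpnorm p `]0%R, 1%R] (oscillation u h) < e%:E.
Proof.
move=> e0; have [M M0 uM] := FB_supported u.
have p0 : (0 < p)%R by exact: lt_le_trans p1.
pose f (n : nat) (a : R) := oscillation u n.+1%:R^-1 a `^ p.
have f_cvg a : `]0%R, 1%R]%classic a -> f ^~ a @ \oo --> 0.
  rewrite /= in_itv/= => /andP[_ a1]; apply: cvge0 => t t0.
  have [d d0 ud] := oscillation_small u a1 (powR_gt0 p^-1 t0).
  near=> n; rewrite poweR_ge0/=.
  (* Writing [t] as a [p]-th power reduces the claim to an oscillation of at most [t^(1/p)]. *)
  have -> : t%:E = ((t `^ p^-1)%:E `^ p).
    by rewrite poweR_EFin -powRrM mulVf ?gt_eqF// powRr1// ltW.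
  apply: le_poweR; [exact: ltW|exact: hausdorff_cut_ge0|apply: ud => //].
  by apply: ltW; near: n; exact: near_infty_natSinv_lt (PosNum d0).
have [||||||_ _ int_cvg] := @dominated_convergence _ _ R lebesgue_measure
    `]0%R, 1%R]%classic _ f (cst 0) (cst ((M + M) `^ p)%:E) => //.
- by move=> n; apply: measurable_poweR_comp; exact: measurable_oscillation.
- by apply: aeW => a; exact: f_cvg.
- apply/integrableP; split; first exact: measurable_cst.
  by rewrite integral_cst//= lebesgue_measure_itv/= lte_fin ltr01 -EFinB -EFinM ltry.
- apply: aeW => a n /=; rewrite in_itv/= => /andP[_ a1].
  rewrite gee0_abs ?poweR_ge0// -poweR_EFin; apply: le_poweR; first exact: ltW.
    exact: hausdorff_cut_ge0.
  apply: hausdorff_supported; [exact: cut_nonempty| |exact: uM|exact: uM].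
  by apply: cut_nonempty; rewrite lerBlDr (le_trans a1)// lerDl.
rewrite integral0 in int_cvg.
have ep0 : 0 < (e `^ p)%:E by rewrite lte_fin powR_gt0.
have /int_cvg[N _ Nlt] : nbhs (0 : \bar R) [set y | y < (e `^ p)%:E].
  exact: open_ereal_lt'.
exists (N.+1%:R^-1)%R; first by rewrite invr_gt0 ltr0n.
move=> h h0 hN; have := Nlt N (leqnn N) => /=.
set I := integral _ _ _ => Ie.
apply: (@le_lt_trans _ _ (I `^ p^-1)).
  apply: lpnorm_le => //; [exact: measurable_oscillation..|].
  move=> a /=; rewrite in_itv/= => /andP[_ a1].
  by rewrite hausdorff_cut_ge0//= oscillation_mono// ltW.
(* Strictness survives the root: otherwise raising to the power [p] would give [e^p <= I]. *)
rewrite ltNge; apply/negP => eI; move: Ie; rewrite ltNge => /negP; apply.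
rewrite -poweR_EFin (_ : I = (I `^ p^-1) `^ p); last first.
  rewrite -poweRrM mulVf ?gt_eqF// poweRe1//.
  by apply: integral_ge0 => a _; exact: poweR_ge0.
by apply: le_poweR => //; rewrite ?lee_fin ltW.
Unshelve. all: by end_near. Qed.

End dp_metric.

(** * Sequential compactness in [FBdp] *)

Section sequential_compactness.
Context {R : realType} {T : topologicalType} (d : T -> T -> \bar R).
Hypothesis dC : forall x y, d x y = d y x.
Hypothesis d_triangle : forall y x z (e : R),
  (d x y < e%:E -> d y z < e%:E -> d x z < (8 * e)%:E)%E.
Hypothesis nbhs_d : forall x (A : set T),
  nbhs x A <-> exists2 e : R, 0 < e & forall y, (d x y < e%:E)%E -> A y.
Implicit Types (U : set T) (x : T).

Definition seq_cluster (u_ : nat -> T) x := forall (e : R) (N : nat), 0 < e ->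
  exists2 n, (N <= n)%N & (d x (u_ n) < e%:E)%E.

(** The cluster point may lie outside [U], which matches compactness of the closure of [U]. *)
Definition seq_clustering U := forall u_, (forall n, U (u_ n)) ->
  exists x, seq_cluster u_ x.

Lemma compact_seq_clustering U : compact (closure U) -> seq_clustering U.
Proof.
move=> cU u_ Uu.
have FU : (u_ @ \oo) (closure U).
  by exists 0%N => // n _; apply: subset_closure; exact: Uu.
have [x [_ xu]] := cU (u_ @ \oo) _ FU; exists x => e N e0.
have [||y [[n Nn <-] xn]] := xu [set u_ n | n in [set n | (N <= n)%N]]
    [set y | d x y < e%:E]%E.
- by exists N => // n Nn; exists n.
- by apply/nbhs_d; exists e.
by exists n.
Qed.

(** Otherwise a greedy choice gives an infinite [e]-separated sequence in [U]; two of its terms lie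
    within [e / 8] of a cluster point, hence within [e] of each other. *)
Lemma seq_clustering_totally_bounded U : seq_clustering U ->
  forall e : R, 0 < e -> exists2 s : seq T, {subset s <= U} &
    forall x, U x -> exists2 y, y \in s & (d y x < e%:E)%E.
Proof.
move=> cU e e0; apply: contrapT => hs.
have [y0 _] : exists y : T, True.
  apply: contrapT => T0; apply: hs; exists [::] => // x _.
  by exfalso; apply: T0; exists x.
(* [y0] is a dummy value that makes the choice of the next point total. *)
have next (s : seq T) : exists y, {subset s <= U} ->
    U y /\ forall x, x \in s -> (e%:E <= d x y)%E.
  have [sU|nsU] := pselect {subset s <= U}; last by exists y0.
  have : ~ forall x, U x -> exists2 y, y \in s & (d y x < e%:E)%E.
    by move=> h; apply: hs; exists s.
  move/existsNP => [y /not_implyP[Uy hy]]; exists y => _; split => // x xs.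
  by rewrite leNgt; apply/negP => xy; apply: hy; exists x.
have [g gP] := choice next.
(* [s_ n] lists the first [n] chosen points, and [g (s_ n)] is the next one. *)
pose s_ := fix s_ n := if n is k.+1 then g (s_ k) :: s_ k else [::].
have sU n : {subset s_ n <= U}.
  elim: n => [//|n ih] x; rewrite inE => /predU1P[->|/ih//].
  by apply/mem_set; case: (gP _ ih).
have smem i j : (i < j)%N -> g (s_ i) \in s_ j.
  elim: j => // j ih; rewrite ltnS leq_eqVlt => /predU1P[->|/ih ij].
    exact: mem_head.
  by rewrite inE ij orbT.
have [x xg] := cU (g \o s_) (fun n => (gP _ (sU n)).1).
have e8 : 0 < e / 8 by rewrite divr_gt0.
have [i _ xi] := xg (e / 8) 0%N e8.
have [j ij xj] := xg (e / 8) i.+1 e8.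
rewrite dC in xi.
have := d_triangle xi xj; rewrite mulrC divfK// ltNge => /negP; apply.
by apply: (gP _ (sU j)).2; exact: smem.
Qed.

Lemma ultra_mem_seq (F : set_system T) (S : eqType) (s : seq S)
    (B : S -> set T) : UltraFilter F ->
  F [set x | exists2 y, y \in s & B y x] -> exists2 y, y \in s & F (B y).
Proof.
move=> UF; elim: s => [|y s ih] Fs.
  by have /filter_ex[x []] := Fs.
have [Fy|Fy] := in_ultra_setVsetC (B y) UF; first by exists y; rewrite ?mem_head.
have [|z zs Fz] := ih; last by exists z; rewrite // inE zs orbT.
apply: filterS (filterI Fs Fy) => x [[z]]; rewrite inE => /predU1P[->//|zs Bz _].
by exists z.
Qed.

(** By total boundedness, an ultrafilter containing the closure of [U] contains for each [n] a ball
    of radius [1/(n+1)] centred in [U]. It converges to any cluster point of these centres. *)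
Lemma seq_clustering_compact U : seq_clustering U -> compact (closure U).
Proof.
move=> cU; rewrite compact_ultra => F UF FU.
have center n : exists y, U y /\ F [set x | d y x < (n.+1%:R^-1)%:E]%E.
  (* The factor 8 pays for replacing a point of the closure by a point of [U] before using the
     net. *)
  have e0 : (0 : R) < n.+1%:R^-1 / 8 by rewrite divr_gt0// invr_gt0.
  have [s sU hs] := seq_clustering_totally_bounded cU e0.
  have [|y ys Fy] := @ultra_mem_seq F _ s
      (fun y => [set x | d y x < (n.+1%:R^-1)%:E]%E) UF.
    apply: filterS FU => x Ux.
    have [|z [Uz xz]] := Ux [set z | d x z < (n.+1%:R^-1 / 8)%:E]%E.
      by apply/nbhs_d; exists (n.+1%:R^-1 / 8).
    have [y ys yz] := hs z Uz; exists y => //=.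
    move: xz => /=; rewrite dC => zx.
    by have := d_triangle yz zx; rewrite mulrC divfK.
  by exists y; split => //; apply/set_mem/sU.
have [y_ yP] := choice center.
have [x xy] := cU y_ (fun n => (yP n).1).
exists x; split.
  move=> A /nbhs_d[e e0 xA]; have [n _ xn] := xy e 0%N e0.
  by exists (y_ n); split; [exact: (yP n).1|exact: xA].
move=> A /nbhs_d[e e0 xA].
have e8 : 0 < e / 8 by rewrite divr_gt0.
have [N _ Ne] := near_infty_natSinv_lt (PosNum e8).
have [n Nn xn] := xy (e / 8) N e8.
apply: filterS (yP n).2 => z /= yz; apply: xA.
have yz' : (d (y_ n) z < (e / 8)%:E)%E.
  by apply: (lt_trans yz); rewrite lte_fin; exact: Ne.
by have := d_triangle xn yz'; rewrite mulrC divfK.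
Qed.

End sequential_compactness.

(** * The topology of d_p *)

Section dp_topology.
Context {R : realType} {m : nat} (p : R) (p1 : 1 <= p).

Lemma dp_triangle_lt (v u w : FB R m) (e : R) :
  (dp p u v < e%:E -> dp p v w < e%:E -> dp p u w < (8 * e)%:E)%E.
Proof.
move=> uv vw; apply: (le_lt_trans (dp_triangle p1 v u w)).
rewrite (_ : 8 * e = 4 * (e + e)); last by ring.
rewrite EFinM lte_pmul2l// EFinD; exact: lteD.
Qed.

(** The quasi-triangle inequality does not show balls to be open, so the open set inside [A] is the
    set of points around which [A] contains a ball; passing from radius [d] to [d / 8] shows it
    open. *)
Lemma nbhs_dp (u : FBdp m p) (A : set (FBdp m p)) :
  nbhs u A <-> exists2 e : R, 0 < e & forall v : FB R m, (dp p (u : FB R m) v < e%:E)%E -> A v.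
Proof.
rewrite nbhsE; split => [[B [oB Bu] BA]|[e e0 uA]].
  by have [e e0 uB] := oB u Bu; exists e => // v /uB/BA.
exists [set v : FBdp m p | exists2 e : R, 0 < e &
    forall w : FB R m, (dp p (v : FB R m) w < e%:E)%E -> A w]; last first.
  by move=> v [d d0 vA]; apply: vA; rewrite (dp_refl p1).
split; last by exists e.
move=> v [d d0 vA]; exists (d / 8); first by rewrite divr_gt0.
move=> w vw; exists (d / 8); first by rewrite divr_gt0.
move=> z wz; apply: vA.
by have := dp_triangle_lt vw wz; rewrite mulrC divfK.
Qed.

Lemma relatively_compact_dp (U : set (FB R m)) :
  @relatively_compact (FBdp m p) U <->
  @seq_clustering R (FBdp m p) (fun u v : FB R m => dp p u v) U.
Proof.
split.
  by apply: compact_seq_clustering => u A; exact: nbhs_dp.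
apply: seq_clustering_compact => [u v|v u w e|u A].
- exact: dp_sym.
- exact: dp_triangle_lt.
- exact: nbhs_dp.
Qed.

End dp_topology.

(** * Fuzzy balls and necessity *)

Section fuzzy_balls.
Context {R : realType} {m : nat}.
Implicit Types (u v : FB R m) (r a : R).

Lemma cut0_sub_ball (f : 'rV[R]_m -> R) (M : R) :
  [set x | 0 < f x] `<=` eucl_ball M -> alpha_cut f 0 `<=` eucl_ball M.
Proof.
move=> fM; rewrite /alpha_cut ltxx.
by rewrite [X in _ `<=` X](closure_id _).1; [exact: closure_subset|exact: closed_eucl_ball].
Qed.

Lemma fuzzy_ballE r (x : 'rV[R]_m) :
  fuzzy_ball r x = if eucl_norm x <= r then 1 else 0.
Proof.
rewrite /fuzzy_ball indicE; case: ifPn => xr.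
  by rewrite mem_set.
by rewrite memNset//=; exact/negP.
Qed.

Lemma fuzzy_ball_range r (x : 'rV[R]_m) : 0 <= fuzzy_ball r x <= 1.
Proof. by rewrite fuzzy_ballE; case: ifP; rewrite ?lexx ?ler01. Qed.

Lemma fuzzy_ball_normal r : 0 <= r -> exists x : 'rV[R]_m, fuzzy_ball r x = 1.
Proof. by move=> r0; exists 0; rewrite fuzzy_ballE eucl_norm0 r0. Qed.

Lemma fuzzy_ball_usc r : upper_semicontinuous (@fuzzy_ball R m r).
Proof.
move=> x a; rewrite fuzzy_ballE; case: ifPn => xr xa.
  apply: filterE => y; rewrite fuzzy_ballE; case: ifP => // _.
  by rewrite (lt_trans ltr01).
have : nbhs x (~` eucl_ball r).
  apply: open_nbhs_nbhs; split; first exact/closed_openC/closed_eucl_ball.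
  exact/negP.
by apply: filterS => y /negP yr; rewrite fuzzy_ballE (negbTE yr).
Qed.

Lemma fuzzy_ball_bounded r :
  exists M : R, forall x, alpha_cut (@fuzzy_ball R m r) 0 x -> eucl_norm x <= M.
Proof.
exists r; apply: cut0_sub_ball => x /=; rewrite fuzzy_ballE.
by case: ifP => //; rewrite ltxx.
Qed.

(** Balls and, below, maxima are bundled as elements of [FB], so that [excess] is a [dp] between
    such elements and measurability carries over. *)
Definition FB_ball r (r0 : 0 <= r) : FB R m :=
  MkFB (fuzzy_ball_range r) (fuzzy_ball_normal r0) (@fuzzy_ball_usc r)
    (fuzzy_ball_bounded r).

Lemma max_range u v x : 0 <= (u \max v) x <= 1.
Proof.
have /andP[u0 u1] := FB_range u x; have /andP[v0 v1] := FB_range v x.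
by rewrite /= le_max u0 ge_max u1.
Qed.

Lemma max_normal u v : exists x, (u \max v) x = 1.
Proof.
have [x ux] := FB_normal u; exists x; apply/eqP.
rewrite /= ux eq_le ge_max lexx le_max lexx/= andbT.
by have /andP[] := FB_range v x.
Qed.

Lemma max_usc u v : upper_semicontinuous (u \max v).
Proof.
move=> x a /=; rewrite gt_max => /andP[ua va].
near=> y; rewrite gt_max; apply/andP; split; near: y; exact: FB_usc.
Unshelve. all: by end_near. Qed.

Lemma max_bounded u v :
  exists M : R, forall x, alpha_cut (u \max v) 0 x -> eucl_norm x <= M.
Proof.
have [M M0 uM] := FB_supported u; have [N N0 vN] := FB_supported v.
have supp (w : FB R m) x : 0 < w x -> alpha_cut w 0 x.
  by move=> wx; rewrite /alpha_cut ltxx; exact: subset_closure.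
exists (Num.max M N); apply: cut0_sub_ball => x /=.
rewrite lt_max /eucl_ball/= le_max => /orP[/supp/uM->//|/supp/vN ->].
by rewrite orbT.
Qed.

Definition FB_max u v : FB R m :=
  MkFB (max_range u v) (max_normal u v) (@max_usc u v) (max_bounded u v).

Lemma cut_fuzzy_ball r a : 0 < a -> a <= 1 ->
  alpha_cut (@fuzzy_ball R m r) a = eucl_ball r.
Proof.
move=> a0 a1; rewrite cut_pos//; apply/seteqP; split => x /=; rewrite fuzzy_ballE.
  by rewrite /eucl_ball/=; case: ifP => // _; rewrite leNgt a0.
by rewrite /eucl_ball/= => ->.
Qed.

Lemma cut_max (f g : 'rV[R]_m -> R) a : 0 < a ->
  alpha_cut (f \max g) a = alpha_cut f a `|` alpha_cut g a.
Proof.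
move=> a0; rewrite !cut_pos//; apply/seteqP; split => x /=; rewrite le_max.
  by case/orP; [left|right].
by case=> ->; rewrite ?orbT.
Qed.

Lemma fuzzy_zeroE : @fuzzy_zero R m = FB_ball (lexx 0).
Proof.
rewrite /= /fuzzy_zero /fuzzy_ball; congr (\1_ _).
apply/seteqP; split => x; rewrite /eucl_ball/=.
  by move=> ->; rewrite eucl_norm0.
move=> x0; apply: eucl_norm_eq0.
by apply/eqP; rewrite eq_le x0 eucl_norm_ge0.
Qed.

End fuzzy_balls.

(** * Cluster points imply the three conditions *)

Section necessity.
Context {R : realType} {m : nat} (p : R) (p1 : 1 <= p).
Implicit Types (u v : FB R m) (U : set (FB R m)) (r a e : R).

Local Notation dp_cluster := (@seq_cluster R (FBdp m p) (fun u v : FB R m => dp p u v)).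

(** Points of the [a]-cut of [v] are no farther from the ball than from the [a]-cut of [u] inside
    it; points of the ball contribute 0. *)
Lemma hausdorff_ball_excess_le r u v a : a <= 1 ->
  alpha_cut u a `<=` eucl_ball r ->
  (hausdorff (alpha_cut v a `|` eucl_ball r) (eucl_ball r) <=
   hausdorff (alpha_cut u a) (alpha_cut v a))%E.
Proof.
move=> a1 ur; have ball0 : @eucl_ball R m r !=set0.
  by have [x ux] := cut_nonempty u a1; exists x; exact: ur.
apply: hausdorff_le; last first.
  by rewrite directed_dist_sub//; exact: hausdorff_cut_ge0.
apply: ge_ereal_sup => _ [x [vx|rx] <-]; last first.
  apply: (@le_trans _ _ 0%E); last exact: hausdorff_cut_ge0.
  by rewrite (le_trans (point_dist_le x rx))// subrr eucl_norm0.
rewrite hausdorffC (le_trans _ (directed_dist_le_hausdorff _ _))//.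
rewrite (le_trans _ (point_dist_le_directed _ vx))//.
by apply: ereal_inf_le_tmp => _ [y uy <-]; exists y => //; exact: ur.
Qed.

Lemma excess_le_dp r u v : 0 <= r -> (forall a, alpha_cut u a `<=` eucl_ball r) ->
  (excess p r v <= dp p u v)%E.
Proof.
move=> r0 ur; rewrite [X in (X <= _)%E](dpE p (FB_max v (FB_ball r0)) (FB_ball r0)).
rewrite dpE; apply: (lpnorm_le p1 (measurable_itv _)
  (measurable_cuts _ _) (measurable_cuts _ _)) => a.
rewrite /= in_itv/= => /andP[a0 a1].
rewrite cut_max// cut_fuzzy_ball// hausdorff_ball_excess_le// andbT.
by apply: hausdorff_ge0; exists 0; right; rewrite /eucl_ball/= eucl_norm0.
Qed.

(** The cuts of [v] at [a] and [a - h] are compared through those of [u] at the same levels.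
    Integrating from [h] keeps [a - h] positive, so the last distance is a translate of the
    integrand of [dp]. *)
Lemma lpnorm_oscillation_dp u v (h : R) : 0 <= h ->
  (lpnorm p `]h, 1%R] (oscillation v h) <=
   4%:E * (dp p u v + 4%:E * (lpnorm p `]0%R, 1%R] (oscillation u h) + dp p u v)))%E.
Proof.
move=> h0; have sub : `]h, 1%R] `<=` `]0%R, 1%R].
  by move=> x /=; rewrite !in_itv/= => /andP[/(le_lt_trans h0)-> ->].
have inh (x : R) : `]h, 1%R]%classic x -> [/\ x <= 1 & x - h <= 1].
  by rewrite /= in_itv/= => /andP[_ x1]; split => //; lra.
pose F a := hausdorff (alpha_cut v a) (alpha_cut u a).
pose G a := hausdorff (alpha_cut u (a - h)) (alpha_cut v (a - h)).
have mF : measurable_fun setT F by exact: measurable_cuts.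
have mG : measurable_fun setT G by exact: measurable_hausdorff_cut.
have mO w : measurable_fun setT (@oscillation R m w h).
  exact: measurable_oscillation.
have F0 a : `]h, 1%R]%classic a -> (0 <= F a)%E.
  by move=> /inh[? _]; exact: hausdorff_cut_ge0.
have G0 a : `]h, 1%R]%classic a -> (0 <= G a)%E.
  by move=> /inh[_ ?]; exact: hausdorff_cut_ge0.
have O0 w a : `]h, 1%R]%classic a -> (0 <= @oscillation R m w h a)%E.
  by move=> /inh[? _]; exact: hausdorff_cut_ge0.
apply: (@le_trans _ _ (lpnorm p `]h, 1%R] (F \+ (oscillation u h \+ G)))%E).
  apply: lpnorm_le => //; first by do 2 apply: emeasurable_funD => //.
  move=> a ha; rewrite O0//=; have [a1 ah1] := inh a ha.
  apply: (le_trans (hausdorff_triangle _ _ (cut_nonempty u a1))).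
  by rewrite leeD2l// hausdorff_triangle//; exact: cut_nonempty.
have mOG : measurable_fun setT (oscillation u h \+ G)%E.
  exact: emeasurable_funD.
have OG0 a : `]h, 1%R]%classic a -> (0 <= (oscillation u h \+ G) a)%E.
  by move=> ha; rewrite adde_ge0 ?O0 ?G0.
have mh : measurable `]h, 1%R]%classic by exact: measurable_itv.
have m01 : measurable (`]0, 1]%classic : set R) by exact: measurable_itv.
apply: (le_trans (lpnorm_add p1 mh mF mOG F0 OG0)).
have four_ge0 : (0 <= 4%:E :> \bar R)%E by rewrite lee_fin.
apply: (lee_wpmul2l four_ge0); apply: leeD.
  by rewrite dp_sym dpE; exact: (lpnorm_subset p1 mh m01 mF sub).
apply: (le_trans (lpnorm_add p1 mh (mO u) mG (O0 u) G0)).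
apply: (lee_wpmul2l four_ge0); apply: leeD.
  exact: (lpnorm_subset p1 mh m01 (mO u) sub).
rewrite dpE; exact: (lpnorm_shift p1 h0 (measurable_cuts u v)).
Qed.

(** This is condition (iii'). *)
Definition asymptotically_supported U := forall u_ : nat -> FB R m,
  (forall n, U (u_ n)) ->
  exists r : R, 0 < r /\
  exists2 phi : nat -> nat, {homo phi : i j / (i < j)%N} &
    excess p r (u_ (phi n)) @[n --> \oo] --> 0%E.

Variable U : set (FB R m).
Hypothesis clusteringU : forall u_ : nat -> FB R m, (forall n, U (u_ n)) ->
  exists u : FB R m, dp_cluster u_ u.

Lemma clustering_bounded : uniformly_pmean_bounded p U.
Proof.
apply: contrapT => nb.
have far (n : nat) : exists u, U u /\ (n%:R%:E < dp p u (@fuzzy_zero R m))%E.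
  apply: contrapT => hn; apply: nb; exists n.+1%:R => // u Uu.
  rewrite leNgt; apply/negP => un; apply: hn; exists u; split => //.
  by apply: lt_trans un; rewrite lte_fin ltr_nat.
have [u_ uP] := choice far.
have [u uu] := clusteringU (fun n => (uP n).1).
have [C C0 uC] := dp_finite p1 u (FB_ball (lexx 0)).
(* [4 * (1 + C)] is the quasi-triangle bound through [u] for a member within 1 of it; an index
   beyond it contradicts the choice of [u_]. *)
have [n Cn un] := uu 1 (Num.trunc (4 * (1 + C))).+1 ltr01.
have := (uP n).2; rewrite fuzzy_zeroE ltNge => /negP; apply.
apply: (le_trans (dp_triangle p1 u _ _)).
apply: (@le_trans _ _ (4 * (1 + C))%:E).
  rewrite EFinM; apply: lee_wpmul2l; first by rewrite lee_fin.
  by rewrite [leRHS]EFinD; apply: (leeD _ uC); rewrite dp_sym; exact: ltW.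
rewrite lee_fin (le_trans (ltW (truncnS_gt _)))// ler_nat//.
Qed.

Lemma clustering_equi_left_continuous : pmean_equi_left_continuous p U.
Proof.
move=> e e0; apply: contrapT => nb.
have bad (n : nat) : exists hu : R * FB R m, [/\ 0 <= hu.1, hu.1 < n.+1%:R^-1,
    U hu.2 & (e%:E <= lpnorm p `]hu.1, 1%R] (oscillation hu.2 hu.1))%E].
  apply: contrapT => hn; apply: nb; exists n.+1%:R^-1 => // h u h0 hn1 Uu.
  rewrite ltNge; apply/negP => eu; apply: hn; exists (h, u); split => //=.
  by rewrite -pmeanE//; exact: measurable_oscillation.
have [hu huP] := choice bad.
have [|u uu] := clusteringU (u_ := fun n => (hu n).2).
  by move=> n; have [] := huP n.
(* [36 = 4 * (1 + 4 * 2)] collects the nested constants of [lpnorm_oscillation_dp]. *)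
have e36 : 0 < e / 36 by rewrite divr_gt0.
have [d d0 ud] := lpnorm_oscillation p1 u e36.
have [N _ Nd] := near_infty_natSinv_lt (PosNum d0).
have [n Nn un] := uu (e / 36) N e36.
have [h0 hn _] := huP n; rewrite leNgt => /negP; apply.
apply: (le_lt_trans (lpnorm_oscillation_dp u _ h0)).
have osc : (lpnorm p `]0%R, 1%R] (oscillation u (hu n).1) < (e / 36)%:E)%E.
  by apply: ud => //; apply: (lt_trans hn); exact: Nd.
have -> : e%:E = (4%:E * ((e / 36)%:E + 4%:E * ((e / 36)%:E + (e / 36)%:E)))%E.
  by rewrite -EFinD -EFinM; congr EFin; field.
rewrite lte_pmul2l//; apply: (lteD un).
by rewrite lte_pmul2l//; exact: (lteD osc un).
Qed.

Lemma subsequence (P : nat -> nat -> Prop) :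
  (forall k N, exists2 n, (N <= n)%N & P k n) ->
  exists2 phi : nat -> nat, {homo phi : i j / (i < j)%N} & forall k, P k (phi k).
Proof.
move=> hP; have hP' (kN : nat * nat) : exists n, (kN.2 <= n)%N /\ P kN.1 n.
  by have [n Nn Pn] := hP kN.1 kN.2; exists n.
have [f fP] := choice hP'.
pose phi := fix phi k := if k is j.+1 then f (k, (phi j).+1) else f (0, 0)%N.
exists phi; last by case=> [|k]; exact: (fP (_, _)).2.
by apply: homo_ltn => [|k]; [exact: ltn_trans|exact: (fP (_, _)).1].
Qed.

(** A ball containing the support of the cluster point serves, since the excess over it is at most
    the distance to that point. *)
Lemma clustering_asymptotically_supported : asymptotically_supported U.
Proof.
move=> u_ Uu; have [u uu] := clusteringU Uu.
have [r r0 ur] := FB_supported u; exists r; split => //.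
have [|phi phi_mono uphi] := @subsequence
    (fun k n => dp p u (u_ n) < (k.+1%:R^-1)%:E)%E.
  by move=> k N; apply: uu; rewrite invr_gt0.
exists phi => //; apply: cvge0 => e e0; near=> n.
rewrite poweR_ge0/= (le_trans (excess_le_dp _ (ltW r0) ur))//.
apply: ltW; apply: (lt_trans (uphi n)); rewrite lte_fin.
by near: n; exact: near_infty_natSinv_lt (PosNum e0).
Unshelve. all: by end_near. Qed.

End necessity.

(** * Sufficiency *)

Lemma ultra_compact_lim {T : Type} {X : topologicalType} (G : set_system T)
    (C : set X) (f : T -> X) : UltraFilter G -> compact C -> G (f @^-1` C) ->
  exists2 x, C x & f @ G --> x.
Proof.
move=> UG cC GC; have [x [Cx fx]] := cC (f @ G) _ GC.
exists x => // A Ax; have [//|GA] := in_ultra_setVsetC (f @^-1` A) UG.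
by have [y [nAy Ay]] := fx (~` A) A GA Ax.
Qed.

(** * Limits of the cuts along an ultrafilter *)

Section limit_cuts.
Context {R : realType} {m : nat} (p : R) (p1 : 1 <= p).
Context (v_ : nat -> FB R m) (r : R) (r0 : 0 < r).
Context (G : set_system nat) {UG : UltraFilter G} (ooG : \oo `<=` G).
Hypothesis excess_cvg : excess p r (v_ n) @[n --> \oo] --> 0%E.
Implicit Types (x y : 'rV[R]_m) (a b e h : R).

Lemma excess_small e : 0 < e -> \forall n \near G, (excess p r (v_ n) < e%:E)%E.
Proof.
move=> e0; apply: ooG.
have : nbhs (0%E : \bar R) [set y | (y < e%:E)%E] by exact: open_ereal_lt'.
by move=> /excess_cvg.
Qed.

Let Ex n a := hausdorff (alpha_cut (v_ n \max fuzzy_ball r) a)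
  (alpha_cut (@fuzzy_ball R m r) a).

Let measurable_Ex n : measurable_fun setT (Ex n).
Proof. exact: (measurable_cuts (FB_max (v_ n) (FB_ball (ltW r0))) (FB_ball (ltW r0))). Qed.

Let excess_lpnorm n : excess p r (v_ n) = lpnorm p `]0%R, 1%R] (Ex n).
Proof. exact: (dpE p (FB_max (v_ n) (FB_ball (ltW r0))) (FB_ball (ltW r0))). Qed.

Let point_dist_Ex n y a : 0 < a -> a <= 1 -> alpha_cut (v_ n) a y ->
  (point_dist y (eucl_ball r) <= Ex n a)%E.
Proof.
move=> a0 a1 ya; rewrite /Ex cut_max// cut_fuzzy_ball//.
rewrite (le_trans _ (directed_dist_le_hausdorff _ _))//.
by apply: point_dist_le_directed; left.
Qed.

Let Ex_ge0 n a : 0 < a -> a <= 1 -> (0 <= Ex n a)%E.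
Proof.
move=> a0 a1; have [y ya] := cut_nonempty (v_ n) a1.
exact: le_trans (point_dist_ge0 _ _) (point_dist_Ex a0 a1 ya).
Qed.

(** A Chebyshev argument: a point of the [a]-cut outside the ball of radius [r + e] lies in all cuts
    at levels in []0, a]], so the integrand of the excess is at least [e] there and the excess at
    least [e a^(1/p)]. *)
Lemma cut_near_ball a e : 0 < a -> a <= 1 -> 0 < e ->
  \forall n \near G, alpha_cut (v_ n) a `<=` eucl_ball (r + e).
Proof.
move=> a0 a1 e0; have ea0 : 0 < e * (a - 0) `^ p^-1.
  by rewrite mulr_gt0// powR_gt0// subr0.
apply: filterS (excess_small ea0) => n; rewrite ltNge => /negP vn y ya.
rewrite /eucl_ball/= leNgt; apply/negP => yr; apply: vn.
rewrite excess_lpnorm -lpnorm_cst//; [|exact: ltW..].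
have sub : (`]0, a]%classic : set R) `<=` `]0, 1].
  by move=> b; rewrite /= !in_itv/= => /andP[-> /le_trans]; exact.
apply: le_trans (lpnorm_subset p1 (measurable_itv _) (measurable_itv _) (measurable_Ex n) sub).
apply: (lpnorm_le p1 (measurable_itv _) (measurable_cst _) (measurable_Ex n)) => b.
rewrite /= in_itv/= lee_fin (ltW e0)/= => /andP[b0 ba].
have yb : alpha_cut (v_ n) b y by exact: cut_anti ya.
apply: le_trans (point_dist_Ex b0 (le_trans ba a1) yb).
apply: le_ereal_inf_tmp => _ [z zr <-]; rewrite lee_fin.
have := eucl_dist_triangle z y 0; rewrite !subr0.
by move: zr; rewrite /eucl_ball/=; lra.
Qed.

(** Kuratowski limit of the [a]-cuts along [G]; for an ultrafilter the lower and upper limits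
    agree. *)
Definition lim_cut a : set 'rV[R]_m := [set x | forall e, 0 < e ->
  \forall n \near G, exists2 y, alpha_cut (v_ n) a y & eucl_norm (x - y) < e].

Lemma lim_cut_anti a b : a <= b -> lim_cut b `<=` lim_cut a.
Proof.
move=> ab x xb e /xb; apply: filterS => n [y yb xy]; exists y => //.
exact: cut_anti yb.
Qed.

Lemma lim_cut_sub_ball a : 0 < a -> a <= 1 -> lim_cut a `<=` eucl_ball r.
Proof.
move=> a0 a1 x xa; rewrite /eucl_ball/=; apply/ler_addgt0Pr => e e0.
have e2 : 0 < e / 2 by rewrite divr_gt0.
have [n [vn [y ya xy]]] := filter_ex (filterI (cut_near_ball a0 a1 e2) (xa _ e2)).
have := vn y ya; rewrite /eucl_ball/=.
have := eucl_dist_triangle y x 0; rewrite !subr0; lra.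
Qed.

Lemma lim_cut_closed a : closed (lim_cut a).
Proof.
move=> x xa e e0; have e2 : 0 < e / 2 by rewrite divr_gt0.
have [z [za xz]] := xa _ (nbhs_eucl_ball x e2).
apply: filterS (za _ e2) => n [y ya zy]; exists y => //.
by have := eucl_dist_triangle z x y; move: xz => /=; lra.
Qed.

(** The ultrafilter replaces extraction of subsequences: selections eventually stay in the compact
    ball of radius [r + 1], so they converge along [G]. *)
Lemma select_lim (a : R) (y_ : nat -> 'rV[R]_m) : 0 < a -> a <= 1 ->
  (forall n, alpha_cut (v_ n) a (y_ n)) ->
  exists2 y, lim_cut a y & forall e, 0 < e ->
    \forall n \near G, eucl_norm (y - y_ n) < e.
Proof.
move=> a0 a1 ya.
have [|y _ yy] := ultra_compact_lim (f := y_) UG (@compact_eucl_ball R m (r + 1)).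
  by apply: filterS (cut_near_ball a0 a1 ltr01) => n; apply; exact: ya.
have near_y e : 0 < e -> \forall n \near G, eucl_norm (y - y_ n) < e.
  by move=> e0; exact: (yy _ (nbhs_eucl_ball y e0)).
exists y => // e /near_y; apply: filterS => n yn; exists (y_ n) => //.
Qed.

Lemma lim_cut_nonempty a : 0 < a -> a <= 1 -> lim_cut a !=set0.
Proof.
move=> a0 a1; have [y_ yP] := choice (fun n => cut_nonempty (v_ n) a1).
by have [y ya _] := select_lim a0 a1 yP; exists y.
Qed.

(** Were it to fail, points of the cuts far from [lim_cut a] would converge along [G] to a point of
    it. With [lim_near_cut] this gives Hausdorff convergence of the cuts. *)
Lemma cut_near_lim a e : 0 < a -> a <= 1 -> 0 < e ->
  \forall n \near G, forall y, alpha_cut (v_ n) a y ->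
    exists2 x, lim_cut a x & eucl_norm (y - x) <= e.
Proof.
move=> a0 a1 e0; pose P n := forall y, alpha_cut (v_ n) a y ->
  exists2 x, lim_cut a x & eucl_norm (y - x) <= e.
have [//|nP] := in_ultra_setVsetC [set n | P n] UG.
(* When [P n] holds an arbitrary point is taken, so that the selection is defined for all [n]. *)
have far n : exists y, alpha_cut (v_ n) a y /\
    (~ P n -> forall x, lim_cut a x -> e < eucl_norm (y - x)).
  have [Pn|/existsNP[y /not_implyP[ya yfar]]] := pselect (P n).
    by have [y ya] := cut_nonempty (v_ n) a1; exists y.
  exists y; split => // _ x xa; rewrite ltNge; apply/negP => yx.
  by apply: yfar; exists x.
have [y_ yP] := choice far.
have [y ya yy] := select_lim a0 a1 (fun n => (yP n).1).
have [n [nPn yn]] := filter_ex (filterI nP (yy e e0)).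
by have := (yP n).2 nPn y ya; rewrite eucl_distC ltNge (ltW yn).
Qed.

(** The limit cut is compact, so points of it far from the cuts of [v_ n] would converge to a point
    of it, which these cuts approach. *)
Lemma lim_near_cut a e : 0 < a -> a <= 1 -> 0 < e ->
  \forall n \near G, forall x, lim_cut a x ->
    exists2 y, alpha_cut (v_ n) a y & eucl_norm (x - y) <= e.
Proof.
move=> a0 a1 e0; pose P n := forall x, lim_cut a x ->
  exists2 y, alpha_cut (v_ n) a y & eucl_norm (x - y) <= e.
have [//|nP] := in_ultra_setVsetC [set n | P n] UG.
have far n : exists x, lim_cut a x /\
    (~ P n -> forall y, alpha_cut (v_ n) a y -> e < eucl_norm (x - y)).
  have [Pn|/existsNP[x /not_implyP[xa xfar]]] := pselect (P n).
    by have [x xa] := lim_cut_nonempty a0 a1; exists x.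
  exists x; split => // _ y ya; rewrite ltNge; apply/negP => xy.
  by apply: xfar; exists y.
have [x_ xP] := choice far.
have clim : compact (lim_cut a).
  apply: (subclosed_compact (@lim_cut_closed a) (@compact_eucl_ball R m r)).
  exact: lim_cut_sub_ball.
have [|x xa xx] := ultra_compact_lim (f := x_) UG clim.
  by apply: filterE => n; exact: (xP n).1.
have e2 : 0 < e / 2 by rewrite divr_gt0.
have near_x : \forall n \near G, eucl_norm (x - x_ n) < e / 2.
  exact: (xx _ (nbhs_eucl_ball x e2)).
have [n [[nPn xn] [y ya xy]]] := filter_ex (filterI (filterI nP near_x) (xa _ e2)).
have := (xP n).2 nPn y ya; have := eucl_dist_triangle x (x_ n) y.
by move: xn; rewrite /= eucl_distC; lra.
Qed.

(** Including 0 makes the set nonempty and its supremum nonnegative. *)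
Definition lim_level x : set R := [set b | b = 0 \/ [/\ 0 < b, b <= 1 & lim_cut b x]].

Definition lim_fun x : R := sup (lim_level x).

Let lim_level_sup x : has_sup (lim_level x).
Proof.
split; first by exists 0; left.
by exists 1 => b [->|[]].
Qed.

Lemma lim_fun_ge a x : 0 < a -> a <= 1 -> lim_cut a x -> a <= lim_fun x.
Proof.
by move=> a0 a1 xa; apply: sup_upper_bound; [exact: lim_level_sup|right].
Qed.

(** With [lim_fun_ge], for [0 < a <= 1] the [a]-cut of [lim_fun] lies between [lim_cut a] and each
    [lim_cut b] with [0 < b < a]. *)
Lemma lim_cut_lt_fun b x : 0 < b -> b < lim_fun x -> lim_cut b x.
Proof.
move=> b0 bx; have [s [->|[_ _ xs]] bs] := sup_gt (lim_level_sup x).1 bx.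
  by have := lt_trans b0 bs; rewrite ltxx.
exact: lim_cut_anti (ltW bs) _ xs.
Qed.

Lemma lim_fun_range x : 0 <= lim_fun x <= 1.
Proof.
apply/andP; split.
  by apply: sup_upper_bound; [exact: lim_level_sup|left].
by apply: ge_sup; [exact: (lim_level_sup x).1|move=> b [->|[]]].
Qed.

Lemma lim_fun_normal : exists x, lim_fun x = 1.
Proof.
have [x x1] := lim_cut_nonempty ltr01 (lexx 1); exists x; apply/eqP.
by rewrite eq_le (andP (lim_fun_range x)).2 lim_fun_ge.
Qed.

Lemma lim_fun_usc : upper_semicontinuous lim_fun.
Proof.
move=> x a xa; have [a1|a1] := ltP 1 a.
  apply: filterE => y; apply: le_lt_trans a1.
  by have /andP[] := lim_fun_range y.
(* For this intermediate level [x] is off the closed set [lim_cut b]; so are its neighbours, whose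
   values are then at most [b]. *)
pose b := (lim_fun x + a) / 2.
have /andP[x0 _] := lim_fun_range x.
have [b0 xb ba] : [/\ 0 < b, lim_fun x < b & b < a].
  by rewrite /b; split; lra.
have nxb : ~ lim_cut b x.
  move=> /(lim_fun_ge b0 (ltW (lt_le_trans ba a1))); rewrite leNgt xb//.
have : nbhs x (~` lim_cut b).
  by apply: open_nbhs_nbhs; split => //; exact/closed_openC/lim_cut_closed.
apply: filterS => y nyb; apply: le_lt_trans ba; rewrite leNgt; apply/negP.
by move=> /(lim_cut_lt_fun b0).
Qed.

Lemma lim_fun_supported : alpha_cut lim_fun 0 `<=` eucl_ball r.
Proof.
apply: cut0_sub_ball => x /= x0; have /andP[_ x1] := lim_fun_range x.
have x20 : 0 < lim_fun x / 2 by rewrite divr_gt0.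
by apply: (lim_cut_sub_ball x20); [lra|apply: lim_cut_lt_fun; lra].
Qed.

Definition FB_lim : FB R m :=
  MkFB lim_fun_range lim_fun_normal lim_fun_usc
    (ex_intro _ r lim_fun_supported).

Lemma cut_FB_lim_sub_ball a : alpha_cut FB_lim a `<=` eucl_ball r.
Proof.
apply: subset_trans lim_fun_supported; have [a0|/ltW a0] := leP a 0.
  by rewrite cut_npos.
exact: cut_anti.
Qed.

(** Both directions pass through the ball of radius [r], which contains the cut of [FB_lim] and has
    diameter at most [2 * r]. This crude bound serves at low levels. *)
Lemma cut_dist_le n a : 0 < a -> a <= 1 ->
  (hausdorff (alpha_cut (v_ n) a) (alpha_cut FB_lim a) <= (2 * r)%:E + Ex n a)%E.
Proof.
move=> a0 a1.
have ur := @cut_FB_lim_sub_ball a.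
have [x0 ux0] := cut_nonempty FB_lim a1.
have ball0 : @eucl_ball R m r !=set0 by exists x0; exact: ur.
have diam x y : eucl_ball r x -> eucl_ball r y -> eucl_norm (x - y) <= 2 * r.
  rewrite /eucl_ball/= => xr yr; rewrite (le_trans (eucl_norm_triangle _ _))//.
  by rewrite eucl_normN; lra.
rewrite addeC; apply: hausdorff_le.
  apply: (le_trans (directed_dist_triangle _ _ ball0)); apply: leeD.
    apply: ge_ereal_sup => _ [y ya <-]; exact: point_dist_Ex.
  by apply: directed_dist_near => x xr; exists x0; [|apply: diam => //; exact: ur].
have [y ya] := cut_nonempty (v_ n) a1.
apply: ge_ereal_sup => _ [x xa <-].
apply: (le_trans (point_dist_le x ya)).
(* The singleton turns the norm into a point-to-set distance, so that the triangle inequality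
   through the ball applies. *)
apply: (@le_trans _ _ (point_dist y [set x])).
  by apply: le_ereal_inf_tmp => _ [_ -> <-]; rewrite eucl_distC.
apply: (le_trans (point_dist_directed _ _ ball0)); apply: leeD.
  exact: point_dist_Ex.
by apply: directed_dist_near => z zr; exists x => //; apply: diam => //; exact: ur.
Qed.

(* [a] lies in [j h, (j + 1) h); the cut of the limit at [a] is compared with
   the cut of [v_ n] at [j h] in one direction and at [(j - 1) h] in the other. *)
Lemma near_cut_dist h e : 0 < h -> 0 < e -> \forall n \near G,
  forall a, 2 * h < a -> a <= 1 ->
    (hausdorff (alpha_cut (v_ n) a) (alpha_cut FB_lim a) <=
      e%:E + (oscillation FB_lim (2 * h) a + oscillation (v_ n) (2 * h) a))%E.
Proof.
(* All [j] with [j h <= 1] are below [N], so finitely many levels suffice and their conditions hold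
   jointly for [G]-most [n]. *)
move=> h0 e0; pose N := (Num.trunc h^-1).+1.
pose P n b := (forall y, alpha_cut (v_ n) b y ->
    exists2 x, lim_cut b x & eucl_norm (y - x) <= e) /\
  (forall x, lim_cut b x ->
    exists2 y, alpha_cut (v_ n) b y & eucl_norm (x - y) <= e).
have : \forall n \near G, forall j : 'I_N,
    0 < j%:R * h -> j%:R * h <= 1 -> P n (j%:R * h).
  apply: filter_forall => j.
  have [j0|j0] := ltP 0 (j%:R * h); last by apply: filterE.
  have [j1|j1] := leP (j%:R * h) 1; last by apply: filterE.
  apply: filterS (filterI (cut_near_lim j0 j1 e0) (lim_near_cut j0 j1 e0)).
  by move=> n [].
apply: filterS => n Pn a ha a1.
pose j := Num.trunc (a / h).
have ah0 : 0 <= a / h by rewrite divr_ge0// ltW// (lt_trans _ ha)// mulr_gt0.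
have /andP[ja aj] := truncn_itv ah0.
rewrite -/j ler_pdivlMr// in ja; rewrite -/j ltr_pdivrMr// -addn1 natrD in aj.
(* [2 * h < a] forces [j >= 2], so the level [(j - 1) h] is positive. *)
have j2 : (1 < j)%N.
  rewrite ltnNge; apply/negP; rewrite -(ler_nat R) => j1.
  by have := ler_wpM2r (ltW h0) j1; lra.
have jh0 : 0 < j%:R * h by rewrite mulr_gt0// ltr0n (ltn_trans _ j2).
have kh0 : 0 < j.-1%:R * h by rewrite mulr_gt0// ltr0n -ltnS prednK// (ltn_trans _ j2).
have jE : j%:R * h = j.-1%:R * h + h.
  by rewrite -[in LHS](prednK (ltn_trans (ltn0Sn 0) j2)) -natr1 mulrDl mul1r.
have jN : (j < N)%N.
  rewrite /N ltnS /j le_truncn// -[leRHS]mul1r ler_pM2r ?invr_gt0//.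
have [nj _] := Pn (Ordinal jN) jh0 (le_trans ja a1).
have [|_ nk] := Pn (Ordinal (leq_ltn_trans (leq_pred j) jN)) kh0; first by rewrite /=; lra.
have a2 : a - 2 * h <= 1 by lra.
apply: hausdorff_le.
  apply: (le_trans (directed_dist_triangle _ _ (cut_nonempty FB_lim a2))).
  apply: leeD.
    apply: directed_dist_near => y /(cut_anti ja)/nj[x xj yx]; exists x => //.
    apply: (@cut_anti _ _ _ _ (j%:R * h)); first by lra.
    by rewrite cut_pos//; exact: lim_fun_ge (le_trans ja a1) xj.
  rewrite -[leLHS]adde0; apply: leeD; last exact: hausdorff_cut_ge0.
  by rewrite /oscillation hausdorffC directed_dist_le_hausdorff.
apply: (le_trans (directed_dist_triangle _ _ (cut_nonempty (v_ n) a2))).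
apply: leeD.
  apply: directed_dist_near => x; rewrite cut_pos; last by lra.
  (* [lim_cut_lt_fun] requires a level strictly below [a]; [j h] may equal [a], whereas
     [(j - 1) h < a], and it still exceeds [a - 2 * h]. *)
  move=> /= xa; have [|y yk xy] := nk x.
    by apply: lim_cut_lt_fun => //; apply: lt_le_trans xa; rewrite /=; lra.
  by exists y => //; apply: cut_anti yk; rewrite /=; lra.
rewrite -[leLHS]add0e; apply: leeD; first exact: hausdorff_cut_ge0.
by rewrite /oscillation hausdorffC directed_dist_le_hausdorff.
Qed.

(** Split []0, 1]] at [2 * h]: [cut_dist_le] handles the short lower interval, [near_cut_dist] and
    the oscillations the upper one. *)
Lemma near_dp (h eta : R) : 0 < h -> 2 * h <= 1 -> 0 < eta ->
  2 * r * (2 * h) `^ p^-1 <= eta ->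
  (lpnorm p `]0%R, 1%R] (oscillation FB_lim (2 * h)) <= eta%:E)%E ->
  (forall n, lpnorm p `](2 * h)%R, 1%R] (oscillation (v_ n) (2 * h)) <= eta%:E)%E ->
  \forall n \near G, (dp p FB_lim (v_ n) <= (176 * eta)%:E)%E.
Proof.
move=> h0 h1 eta0 small_r small_u small_v; set k := 2 * h.
have k0 : 0 < k by rewrite /k mulr_gt0.
have m1 : measurable (`]0, k]%classic : set R) by exact: measurable_itv.
have m2 : measurable (`]k, 1]%classic : set R) by exact: measurable_itv.
have m01 : measurable (`]0, 1]%classic : set R) by exact: measurable_itv.
have sub1 : (`]0, k]%classic : set R) `<=` `]0, 1].
  by move=> a; rewrite /= !in_itv/= => /andP[-> /le_trans]; exact.
have sub2 : (`]k, 1]%classic : set R) `<=` `]0, 1].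
  by move=> a; rewrite /= !in_itv/= => /andP[/(lt_trans k0)-> ->].
have disj : [disjoint (`]0, k]%classic : set R) & `]k, 1]%classic].
  rewrite disj_set2E; apply/eqP/seteqP; split => // a [] /=.
  by rewrite !in_itv/= => /andP[_ ak] /andP[/(le_lt_trans ak)]; rewrite ltxx.
have four_ge0 : (0 <= 4%:E :> \bar R)%E by rewrite lee_fin.
have mO w : measurable_fun setT (@oscillation R m w k).
  exact: measurable_oscillation.
have mc (c : R) : measurable_fun setT (cst c%:E : R -> \bar R).
  exact: measurable_cst.
apply: filterS (filterI (near_cut_dist h0 eta0) (excess_small eta0)) => n [nH /ltW nE].
have mH : measurable_fun setT
    (fun a : R => hausdorff (alpha_cut (v_ n) a) (alpha_cut FB_lim a)).
  exact: measurable_cuts.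
rewrite dp_sym dpE.
rewrite (_ : `]0, 1]%classic = `]0, k] `|` `]k, 1]); last first.
  by rewrite -itv_bndbnd_setU// bnd_simp ltW.
(* The bound nests the factors 4: two summands on the lower part and three on the upper, each at
   most [eta]. *)
have -> : (176 * eta)%:E = (4%:E * (4%:E * (eta%:E + eta%:E) +
    4%:E * (eta%:E + 4%:E * (eta%:E + eta%:E))))%E.
  by rewrite -!(EFinD, EFinM); congr EFin; ring.
apply: (le_trans (lpnorm_setU p1 m1 m2 mH disj)).
apply: (lee_wpmul2l four_ge0); apply: leeD.
  apply: (@le_trans _ _ (lpnorm p `]0%R, k] (cst (2 * r)%:E \+ Ex n))%E).
    apply: (lpnorm_le p1 m1 mH (emeasurable_funD (mc _) (measurable_Ex n))) => a /sub1.
    rewrite /= in_itv/= => /andP[a0 a1].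
    by rewrite hausdorff_cut_ge0//= cut_dist_le.
  apply: (le_trans (lpnorm_add p1 m1 (mc _) (measurable_Ex n) _ _)).
  - by move=> a _; rewrite lee_fin mulr_ge0// ltW.
  - by move=> a /sub1; rewrite /= in_itv/= => /andP[]; exact: Ex_ge0.
  apply: (lee_wpmul2l four_ge0); apply: leeD.
    by rewrite lpnorm_cst ?lee_fin ?subr0// ?mulr_ge0// ltW.
  apply: le_trans nE; rewrite excess_lpnorm.
  exact: (lpnorm_subset p1 m1 m01 (measurable_Ex n) sub1).
have mOO : measurable_fun setT (oscillation FB_lim k \+ oscillation (v_ n) k)%E.
  exact: emeasurable_funD.
have O0 w a : `]k, 1%R]%classic a -> (0 <= @oscillation R m w k a)%E.
  by rewrite /= in_itv/= => /andP[_ ?]; exact: hausdorff_cut_ge0.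
apply: (@le_trans _ _ (lpnorm p `]k, 1%R] (cst eta%:E \+
    (oscillation FB_lim k \+ oscillation (v_ n) k)))%E).
  apply: (lpnorm_le p1 m2 mH (emeasurable_funD (mc _) mOO)) => a.
  rewrite /= in_itv/= => /andP[ka a1].
  by rewrite hausdorff_cut_ge0//= nH.
apply: (le_trans (lpnorm_add p1 m2 (mc _) mOO _ _)).
- by move=> a _; rewrite lee_fin ltW.
- by move=> a ha; rewrite adde_ge0 ?O0.
apply: (lee_wpmul2l four_ge0); apply: leeD.
  have k1 : (1 - k) `^ p^-1 <= 1.
    rewrite [leRHS](_ : 1 = 1 `^ p^-1); last by rewrite powR1.
    apply: ge0_ler_powR.
    - by rewrite invr_ge0 (le_trans _ p1).
    - by rewrite nnegrE subr_ge0.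
    - by rewrite nnegrE.
    - by rewrite gerBl ltW.
  rewrite (lpnorm_cst p1 h1 (ltW eta0)).
  by rewrite lee_fin ler_piMr// ltW.
apply: (le_trans (lpnorm_add p1 m2 (mO _) (mO _) (O0 _) (O0 _))).
apply: (lee_wpmul2l four_ge0); apply: leeD; last exact: small_v.
exact: le_trans (lpnorm_subset p1 m2 m01 (mO _) sub2) small_u.
Qed.

End limit_cuts.

(** * Construction of cluster points *)

Section sufficiency.
Context {R : realType} {m : nat} (p : R) (p1 : 1 <= p) (U : set (FB R m)).
Hypothesis leftU : pmean_equi_left_continuous p U.
Hypothesis suppU : asymptotically_supported p U.

(** The cluster point is [FB_lim] of the subsequence along an ultrafilter, chosen independently of
    [e]; only the step [h] for [near_dp] depends on [e]. *)
Lemma supported_clustering : @seq_clustering R (FBdp m p)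
  (fun u v : FB R m => dp p u v) U.
Proof.
move=> u_ Uu; have [r [r0 [phi phi_mono excess0]]] := suppU Uu.
pose v_ n : FB R m := u_ (phi n).
have [G [UG ooG]] := ultraFilterLemma (F := \oo) _.
exists (FB_lim p1 r0 ooG (v_ := v_) excess0 : FB R m) => e N e0.
(* 177 makes the bound [176 * eta] strictly less than [e]. *)
pose eta := e / 177; have eta0 : 0 < eta by rewrite /eta; lra.
set u := FB_lim _ _ _ _.
have [d d0 ud] := lpnorm_oscillation p1 u eta0.
have [d' d'0 vd] := leftU eta0.
(* [c] solves [2 r c^(1/p) = eta]. *)
pose c := (eta / (2 * r)) `^ p.
have c0 : 0 < c by rewrite powR_gt0// divr_gt0// mulr_gt0.
(* With the factor 4, [2 * h] is half the minimum, hence strictly below all four bounds. *)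
pose h := Num.min (Num.min d d') (Num.min c 1) / 4.
have min0 : 0 < Num.min (Num.min d d') (Num.min c 1).
  by rewrite !lt_min d0 d'0 c0 ltr01.
have h0 : 0 < h by rewrite divr_gt0.
have hmin : 2 * h < Num.min (Num.min d d') (Num.min c 1) by rewrite /h; lra.
move: (hmin); rewrite !lt_min => /andP[/andP[hd hd'] /andP[hc h1]].
have h20 : 0 <= 2 * h by rewrite mulr_ge0// ltW.
have small_r : 2 * r * (2 * h) `^ p^-1 <= eta.
  have r20 : 0 < 2 * r by rewrite mulr_gt0.
  rewrite mulrC -ler_pdivlMr//.
  have -> : eta / (2 * r) = c `^ p^-1.
    by rewrite /c -powRrM divff ?powRr1 ?gt_eqF ?(lt_le_trans _ p1)// divr_ge0// ltW.
  apply: ge0_ler_powR; rewrite ?nnegrE ?invr_ge0 ?(ltW c0) ?(ltW hc)//.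
  exact: le_trans p1.
have small_v n : (lpnorm p `](2 * h)%R, 1%R] (oscillation (v_ n) (2 * h)) <= eta%:E)%E.
  rewrite -pmeanE; last exact: measurable_oscillation.
  by apply: ltW; apply: vd => //; exact: Uu.
have close := near_dp h0 (ltW h1) eta0 small_r (ltW (ud _ h20 hd)) small_v.
have tail : G [set n | (N <= n)%N] by apply: (ooG); exists N.
have [n [un Nn]] := filter_ex (filterI close tail).
(* Late indices of the subsequence are thus late indices of [u_]. *)
have phi_ge k : (k <= phi k)%N.
  by elim: k => // k ih; rewrite (leq_ltn_trans ih)// phi_mono.
exists (phi n); first exact: leq_trans (phi_ge n).
by apply: (le_lt_trans un); rewrite lte_fin /eta; lra.
Qed.

End sufficiency.

Theorem theorem5p7 (R : realType) (m : nat) (p : R) (U : set (FB R m))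
    (hm : (1 <= m)%N) (hp : 1 <= p) :
  @relatively_compact (FBdp m p) U <->
  [/\ uniformly_pmean_bounded p U,
      pmean_equi_left_continuous p U &
      forall u_ : nat -> FB R m, (forall n, U (u_ n)) ->
        exists r : R, 0 < r /\
        exists2 phi : nat -> nat, {homo phi : i j / (i < j)%N} &
          excess p r (u_ (phi n)) @[n --> \oo] --> 0%E].
Proof.
rewrite relatively_compact_dp//; split=> [cU|[_ leftU suppU]].
  split.
  - exact: clustering_bounded.
  - exact: clustering_equi_left_continuous.
  - exact: clustering_asymptotically_supported.
exact: supported_clustering.
Qed.
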